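(* Let $\{P_t\}_{t\geq 0}$ be a Markov--Feller semigroup on a Polish space $\mathcal{X}$. The following are equivalent: (i) $\{P_t\}_{t\geq 0}$ is asymptotically stable (with unique invariant measure $\mu$); (ii) $\{P_t\}_{t\geq 0}$ is eventually continuous at every point of $\mathcal{X}$, and there exists $z\in\mathcal{X}$ such that for every $\epsilon>0$, $\inf_{x\in\mathcal{X}}\liminf_{t\to\infty}P_t(x,B(z,\epsilon))>0$; (iii) there exists $z\in\mathcal{X}$ such that $\{P_t\}_{t\geq 0}$ is eventually continuous at $z$ and for every $\epsilon>0$, $\inf_{x\in\mathcal{X}}\liminf_{t\to\infty}P_t(x,B(z,\epsilon))>0$.
   Context: $(\mathcal{X},\rho)$ is a Polish space, $B(z,\epsilon)$ the open ball, $\mathcal{P}(\mathcal{X})$ the Borel probability measures. A Markov--Feller semigroup $\{P_t\}_{t\ge0}$ is a semigroup of mass-preserving positively linear operators on finite Borel measures, each with a dual linear operator on bounded Borel functions ($\langle f,P_t\mu\rangle=\langle P_tf,\mu\rangle$) preserving bounded continuous functions; $P_t(x,A):=(P_t\delta_x)(A)$. Asymptotically stable: there is a unique invariant probability measure $\mu_*$ and $P_t\mu\to\mu_*$ weakly as $t\to\infty$ for every $\mu\in\mathcal{P}(\mathcal{X})$. Eventually continuous at $z$: for every bounded Lipschitz $f$, $\limsup_{x\to z}\limsup_{t\to\infty}|P_tf(x)-P_tf(z)|=0$. *)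

(* Defs.v *)
From HB Require Import structures.
From mathcomp Require Import all_boot all_order all_algebra.
From mathcomp Require Import all_classical all_reals all_analysis.
Set Implicit Arguments. Unset Strict Implicit. Unset Printing Implicit Defensive.
Import Order.TTheory GRing.Theory Num.Theory.
Import numFieldNormedType.Exports.
Local Open Scope classical_set_scope.
Local Open Scope ring_scope.

(** Pointed metric spaces (a metric space with a distinguished inhabitant;
    needed because MathComp-Analysis measurable types are pointed). *)
#[short(type="pmetricType")]
HB.structure Definition PMetric (K : numDomainType) :=
  { M of Pointed M & Metric K M }.

Notation borel X := (g_sigma_algebraType (@open X)).

Notation fmeasure X R := {finite_measure set (borel X) -> \bar R}.

Section defs.
Context {R : realType} {X : pmetricType R}.

Definition complete_metric : Prop :=
  forall F : set_system X, ProperFilter F -> cauchy F -> exists x : X, F --> x.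
Definition separable : Prop :=
  exists D : set X, countable D /\ dense D.
Definition polish : Prop := complete_metric /\ separable.

Definition bounded_fun (f : X -> R) : Prop := exists M : R, forall x, `|f x| <= M.
Definition borel_fun (f : X -> R) : Prop :=
  measurable_fun setT (f : borel X -> R).
Definition bounded_borel (f : X -> R) : Prop := bounded_fun f /\ borel_fun f.
Definition bounded_continuous (f : X -> R) : Prop := bounded_fun f /\ continuous f.
Definition lipschitz_fun (f : X -> R) : Prop :=
  exists L : R, forall x y : X, `|f x - f y| <= L * mdist x y.
Definition bounded_lipschitz (f : X -> R) : Prop := bounded_fun f /\ lipschitz_fun f.

Definition integ (mu : fmeasure X R) (f : X -> R) : \bar R :=
  (\int[mu]_(x in setT) (f x)%:E)%E.

Definition is_prob (mu : fmeasure X R) : Prop := mu setT = 1%E.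

Definition markov_feller (Pm : R -> fmeasure X R -> fmeasure X R)
    (Pf : R -> (X -> R) -> (X -> R)) : Prop :=
  [/\
      (forall t mu, 0 <= t -> Pm t mu setT = mu setT),
      (forall t (mu nu la : fmeasure X R) (a b : R), 0 <= t -> 0 <= a -> 0 <= b ->
         (forall A, measurable A -> la A = (a%:E * mu A + b%:E * nu A)%E) ->
         forall A, measurable A -> Pm t la A = (a%:E * Pm t mu A + b%:E * Pm t nu A)%E),
      (forall mu A, measurable A -> Pm 0 mu A = mu A) /\
      (forall s t mu A, 0 <= s -> 0 <= t -> measurable A ->
         Pm (s + t) mu A = Pm t (Pm s mu) A),
      (forall t f, 0 <= t -> bounded_borel f ->
         bounded_borel (Pf t f) /\ forall mu, integ (Pm t mu) f = integ mu (Pf t f)) /\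
      (forall t f g (a b : R), 0 <= t -> bounded_borel f -> bounded_borel g ->
         Pf t (fun x => a * f x + b * g x) = (fun x => a * Pf t f x + b * Pf t g x)) &
      (forall t f, 0 <= t -> bounded_continuous f -> continuous (Pf t f))].

Definition trans (Pm : R -> fmeasure X R -> fmeasure X R) (t : R) (x : X)
    (A : set X) : \bar R :=
  Pm t (\d_(x : borel X)) A.

Definition invariant (Pm : R -> fmeasure X R -> fmeasure X R)
    (mu : fmeasure X R) : Prop :=
  forall t A, 0 <= t -> measurable A -> Pm t mu A = mu A.

Definition weak_cvg_pinfty (mu_ : R -> fmeasure X R) (nu : fmeasure X R) : Prop :=
  forall f, bounded_continuous f ->
    (fun t => integ (mu_ t) f) @ pinfty_nbhs R --> integ nu f.

Definition asymptotically_stable (Pm : R -> fmeasure X R -> fmeasure X R) : Prop :=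
  exists mus : fmeasure X R,
    [/\ is_prob mus, invariant Pm mus,
        (forall nu : fmeasure X R, is_prob nu -> invariant Pm nu ->
           forall A, measurable A -> nu A = mus A) &
        (forall mu : fmeasure X R, is_prob mu -> weak_cvg_pinfty (fun t => Pm t mu) mus)].

Definition eventually_continuous_at (Pf : R -> (X -> R) -> (X -> R)) (z : X) : Prop :=
  forall f, bounded_lipschitz f ->
    limf_esup (fun x => limf_esup (fun t => (`|Pf t f x - Pf t f z|)%:E)
                                  (pinfty_nbhs R))
              (nbhs z) = 0%E.

Definition lower_bound_cond (Pm : R -> fmeasure X R -> fmeasure X R) (z : X) : Prop :=
  forall eps : R, 0 < eps ->
    (0 < ereal_inf [set limf_einf (fun t => trans Pm t x (ball z eps)) (pinfty_nbhs R)
                   | x in [set: X]])%E.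

End defs.

(* Main.v *)
(** (iii) => (i).  Let [S] be the largest asymptotic oscillation
    [limsup_t (P_t f x - P_t f y)] of a Lipschitz function [f], over all [x, y].
    Choose a ball [B] around [z] on which eventual continuity makes the
    asymptotic oscillation at most [eta], and a time [s] at which the laws from
    [x] and from [y] both charge [B] with mass at least [b]; restarting at time [s]
    gives [S <= S - b^2 (S - eta)], so [S = 0]: all orbits merge.

    For existence, the laws [mu_n = P_n(z, .)] are tight.  If not, there are Lipschitz
    functions [f_i] with disjoint supports and times [n_i] with [mu_{n_i}(f_i) >= eps].
    By merging and a gliding hump, [P_{n_i} f_i x >= eps/2] for every [x] and all large
    [i]; Baire's theorem on the closed set of points charged by the [mu_n] makes this
    uniform on the trace of a ball, which all late [mu_m] charge with mass at least
    [beta].  Hence [mu_M(f_i) >= beta eps/2] for arbitrarily many [i] at a common time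
    [M], although [sum_i f_i <= 1].  An ultrafilter limit of the tight sequence [mu_n]
    is realised as the image of Lebesgue measure on [0,1[, by coding nested partitions
    into small cells by nested intervals.  Merging makes this limit invariant and
    attracting.

    (i) => (ii): [P_t f] converges pointwise to a constant, and the centre [z] can be
    any point of the support of the invariant measure. *)
Require Import Defs.
From HB Require Import structures.
From mathcomp Require Import all_boot all_order all_algebra.
From mathcomp Require Import all_classical all_reals all_analysis.
From mathcomp Require Import measurable_realfun.
From mathcomp Require Import ring lra.
Import Defs.
Import Order.TTheory GRing.Theory Num.Theory.
Import numFieldNormedType.Exports.
Local Open Scope classical_set_scope.
Local Open Scope ring_scope.
Set Implicit Arguments. Unset Strict Implicit. Unset Printing Implicit Defensive.

(** * Means of bounded Borel functions *)

Section mean.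
Context {R : realType} {X : pmetricType R}.
Implicit Types (mu nu : fmeasure X R) (f g : X -> R) (A B : set X).

(** Real-valued, so that real limits and linear arithmetic apply. By [integE] nothing is lost on
    bounded Borel functions, whose integrals against finite measures are finite. *)
Definition mean mu f : R := fine (integ mu f).

Lemma cts_borel f : continuous f -> borel_fun f.
Proof.
move=> /continuousP cf; apply: (measurability _ (RGenOpens.measurableE R)).
move=> _ [_ [a [b ->] <-]]; rewrite setTI.
by apply: sub_sigma_algebra; exact/cf/interval_open.
Qed.

Lemma open_borel A : open A -> measurable (A : set (borel X)).
Proof. exact: sub_sigma_algebra. Qed.

Lemma open_mball (x : X) (e : R) : open (ball x e).
Proof.
rewrite openE => y /=; rewrite ballEmdist /= => xy.
apply: (metricType_numDomainType.nbhs_mdistP y _).2.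
exists (e - mdist x y); first by rewrite /= subr_gt0.
move=> w /= yw.
by rewrite (le_lt_trans (metric_triangle x y w))// -ltrBrDl.
Qed.

Lemma ball_borel (x : X) (e : R) : measurable (ball x e : set (borel X)).
Proof. by apply: open_borel; exact: open_mball. Qed.

Lemma bb_cst (c : R) : bounded_borel (fun _ : X => c).
Proof. by split; [exists `|c| => x|exact: measurable_cst]. Qed.

Lemma bbD f g : bounded_borel f -> bounded_borel g ->
  bounded_borel (fun x => f x + g x).
Proof.
move=> [[M fM] mf] [[N gN] mg]; split; last exact: measurable_funD.
by exists (M + N) => x; rewrite (le_trans (ler_normD _ _))// lerD.
Qed.

Lemma bbZ (c : R) f : bounded_borel f -> bounded_borel (fun x => c * f x).
Proof.
move=> [[M fM] mf]; split; last by apply: measurable_funM => //; exact: measurable_cst.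
by exists (`|c| * M) => x; rewrite normrM ler_wpM2l.
Qed.

Lemma bbB f g : bounded_borel f -> bounded_borel g ->
  bounded_borel (fun x => f x - g x).
Proof.
move=> bf bg; have := bbD bf (bbZ (-1) bg).
by under [X in bounded_borel X]eq_fun do rewrite mulN1r.
Qed.

Lemma bb_max f g : bounded_borel f -> bounded_borel g ->
  bounded_borel (fun x => Num.max (f x) (g x)).
Proof.
move=> [[M fM] mf] [[N gN] mg]; split; last exact: measurable_maxr.
exists (Num.max M N) => x; rewrite le_max.
by case: (leP (f x) (g x)) => _; rewrite ?fM ?gN ?orbT.
Qed.

Lemma bb_indic A : measurable (A : set (borel X)) -> bounded_borel (\1_A : X -> R).
Proof.
move=> mA; split; last exact: measurable_indic.
by exists 1 => x; rewrite indicE; case: (x \in A); rewrite ?normr1 ?normr0.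
Qed.

Lemma bb_sum (I : Type) (s : seq I) (F : I -> X -> R) :
  (forall i, bounded_borel (F i)) ->
  bounded_borel (fun x => \sum_(i <- s) F i x).
Proof.
move=> bF; elim: s => [|i s IH].
  by under [X in bounded_borel X]eq_fun do rewrite big_nil; exact: bb_cst.
by under [X in bounded_borel X]eq_fun do rewrite big_cons; exact: bbD.
Qed.

Lemma bb_integrable mu f : bounded_borel f ->
  mu.-integrable setT (EFin \o (f : borel X -> R)).
Proof.
move=> [[M fM] mf]; apply: measurable_bounded_integrable => //.
  by rewrite -ge0_fin_numE// fin_num_measure.
exists M; split; first by rewrite num_real.
by move=> y My x _ /=; rewrite (le_trans (fM x))// ltW.
Qed.

Lemma integE mu f : bounded_borel f -> integ mu f = (mean mu f)%:E.
Proof.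
by move=> /(bb_integrable mu) bf; rewrite /mean fineK//; exact: integrable_fin_num.
Qed.

Lemma meanE mu f : mean mu f = \int[mu]_(x in setT) (f : borel X -> R) x.
Proof. by []. Qed.

Lemma meanD mu f g : bounded_borel f -> bounded_borel g ->
  mean mu (fun x => f x + g x) = mean mu f + mean mu g.
Proof. by move=> bf bg; rewrite !meanE RintegralD//; exact: bb_integrable. Qed.

Lemma meanB mu f g : bounded_borel f -> bounded_borel g ->
  mean mu (fun x => f x - g x) = mean mu f - mean mu g.
Proof. by move=> bf bg; rewrite !meanE RintegralB//; exact: bb_integrable. Qed.

Lemma meanZ mu (c : R) f : bounded_borel f ->
  mean mu (fun x => c * f x) = c * mean mu f.
Proof. by move=> bf; rewrite !meanE RintegralZl//; exact: bb_integrable. Qed.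

Lemma le_mean mu f g : bounded_borel f -> bounded_borel g ->
  (forall x, f x <= g x) -> mean mu f <= mean mu g.
Proof.
by move=> bf bg fg; rewrite !meanE le_Rintegral//; exact: bb_integrable.
Qed.

Lemma mean_sum mu (I : Type) (s : seq I) (F : I -> X -> R) :
  (forall i, bounded_borel (F i)) ->
  mean mu (fun x => \sum_(i <- s) F i x) = \sum_(i <- s) mean mu (F i).
Proof.
move=> bF; elim: s => [|i s IH].
  rewrite big_nil meanE; under eq_Rintegral do rewrite big_nil.
  by rewrite Rintegral_cst// mul0r.
rewrite big_cons -IH -meanD//; last exact: bb_sum.
by congr mean; apply/funext => x; rewrite big_cons.
Qed.

Lemma mean_cst mu (c : R) : is_prob mu -> mean mu (fun=> c) = c.
Proof. by move=> pm; rewrite meanE Rintegral_cst//= pm mulr1. Qed.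

Lemma mean_indic mu A : measurable (A : set (borel X)) ->
  mean mu (\1_A) = fine (mu A).
Proof. by move=> mA; rewrite /mean /integ integral_indic// setIT. Qed.

Lemma measure_mean mu A : measurable (A : set (borel X)) ->
  mu A = (mean mu (\1_A))%:E.
Proof. by move=> mA; rewrite mean_indic// fineK// fin_num_measure. Qed.

(** Dominated convergence with the constant [M] as dominating function, integrable because [mu] is
    finite. *)
Lemma mean_dct mu (h : nat -> X -> R) f (M : R) :
  (forall n, bounded_borel (h n)) -> (forall n x, `|h n x| <= M) ->
  (forall x, h n x @[n --> \oo] --> f x) ->
  bounded_borel f /\ mean mu (h n) @[n --> \oo] --> mean mu f.
Proof.
move=> bh hM hf.
have bf : bounded_borel f.
  split; last first.
    apply: (@measurable_fun_cvg _ (borel X) R setT (h : nat -> borel X -> R)) => [n|x _].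
      by have [] := bh n.
    exact: hf.
  exists M => x.
  have H : `|h n x| @[n --> \oo] --> `|f x| by apply: cvg_norm; exact: hf.
  by apply: (cvgr_to_le H); apply: nearW => n; exact: hM.
split => //.
have [] := @dominated_convergence _ (borel X) R mu setT measurableT
  (fun n => EFin \o h n) (EFin \o f) (cst M%:E).
- by move=> n; have /integrableP[] := bb_integrable mu (bh n).
- by have /integrableP[] := bb_integrable mu bf.
- by apply: aeW => x _; apply/fine_cvgP; split; [exact: nearW|exact: hf].
- exact: bb_integrable (bb_cst M).
- by apply: aeW => x n _ /=; rewrite lee_fin.
move=> _ _ H; apply/fine_cvg.
by rewrite -(integE mu bf).
Qed.

Lemma eq_mean mu nu f :
  (forall A, measurable (A : set (borel X)) -> mu A = nu A) -> mean mu f = mean nu f.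
Proof.
move=> mn; rewrite /mean /integ.
by rewrite (@eq_measure_integral _ _ _ _ nu)// => A mA _; exact: mn.
Qed.
End mean.

(** * Lipschitz functions and weak convergence *)

Section lipschitz.
Context {R : realType} {X : pmetricType R}.
Implicit Types (mu nu : fmeasure X R) (f g : X -> R) (A B : set X).
Local Notation d := (@mdist R X).

(** The test class of the whole proof: it determines measures ([measure_eq_lip]) and weak
    convergence ([portmanteau]), and it is stable under [f] to [1 - f], which turns one-sided
    estimates into two-sided ones. *)
Definition lip01 f := (forall x, 0 <= f x <= 1) /\ lipschitz_fun f.

Lemma lipschitz_ge1 f : lipschitz_fun f ->
  exists2 L : R, 1 <= L & forall x y, `|f x - f y| <= L * d x y.
Proof.
move=> [L fL]; exists (Num.max 1 L); first by rewrite le_max lexx.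
move=> x y; rewrite (le_trans (fL x y))// ler_wpM2r ?mdist_ge0//.
by rewrite le_max lexx orbT.
Qed.

Lemma lipschitz_cts f : lipschitz_fun f -> continuous f.
Proof.
move=> /lipschitz_ge1[L L1 fL] x; apply/cvgrPdist_lt => e e0.
have L0 : 0 < L by apply: lt_le_trans L1.
apply: (metricType_numDomainType.nbhs_mdistP x (fun y => `|f x - f y| < e)).2.
exists (e / L); first by rewrite /= divr_gt0.
by move=> y /=; rewrite ltr_pdivlMr// mulrC; apply: le_lt_trans.
Qed.

Lemma lip01_cts f : lip01 f -> continuous f.
Proof. by move=> [_ /lipschitz_cts]. Qed.

Lemma bounded01 f : (forall x, 0 <= f x <= 1) -> bounded_fun f.
Proof. by move=> f01; exists 1 => x; have /andP[f0 f1] := f01 x; rewrite ger0_norm. Qed.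

Lemma lip01_bl f : lip01 f -> bounded_lipschitz f.
Proof. by move=> [f01 fL]; split => //; exact: bounded01. Qed.

Lemma lip01_bc f : lip01 f -> bounded_continuous f.
Proof. by move=> lf; split; [exact: (lip01_bl lf).1|exact: lip01_cts]. Qed.

Lemma bc_bb f : bounded_continuous f -> bounded_borel f.
Proof. by move=> [bf cf]; split => //; exact: cts_borel. Qed.

Lemma lip01_bb f : lip01 f -> bounded_borel f.
Proof. by move=> /lip01_bc/bc_bb. Qed.

Lemma lip01_onem f : lip01 f -> lip01 (fun x => 1 - f x).
Proof.
move=> [f01 [L fL]]; split; first by move=> x; have := f01 x; lra.
exists L => x y; rewrite (_ : 1 - f x - (1 - f y) = - (f x - f y)); last by ring.
by rewrite normrN.
Qed.

(** The maximum is nonexpansive for the sup norm; hence finite maxima of [K]-Lipschitz functions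
    stay [K]-Lipschitz. *)
Lemma ler_norm_max (a b c e : R) :
  `|Num.max a b - Num.max c e| <= Num.max `|a - c| `|b - e|.
Proof.
rewrite le_max; have /orP[] := real_leVge (num_real a) (num_real b) => ab;
 have /orP[] := real_leVge (num_real c) (num_real e) => ce.
- by rewrite (max_r ab) (max_r ce) lexx orbT.
- rewrite (max_r ab) (max_l ce); apply/orP.
  have [bc|bc] := leP c b; [right|left].
    by rewrite !ger0_norm; lra.
  by rewrite !ler0_norm; lra.
- rewrite (max_l ab) (max_r ce); apply/orP.
  have [bc|bc] := leP e a; [left|right].
    by rewrite !ger0_norm; lra.
  by rewrite !ler0_norm; lra.
- by rewrite (max_l ab) (max_l ce) lexx.
Qed.

(** Lower semicontinuity, the common generality of continuous functions and indicators of open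
    sets. *)
Definition lsc f := forall x a, a < f x ->
  exists2 e : R, 0 < e & forall y, d x y < e -> a < f y.

Lemma cts_lsc f : continuous f -> lsc f.
Proof.
move=> cf x a afx.
have : \forall y \near x, a < f y by exact: cvgr_gt _ (cf x) _ afx.
by move=> /metricType_numDomainType.nbhs_mdistP[e /= e0 He]; exists e => // y /He.
Qed.

Lemma open_lsc A : open A -> lsc (\1_A : X -> R).
Proof.
move=> oA x a; rewrite indicE; have [xA|xA] := boolP (x \in A) => /= ax; last first.
  exists 1 => // y _; apply: lt_le_trans ax _.
  by rewrite indicE; case: (y \in A).
have : nbhs x A by apply: open_nbhs_nbhs; split => //; exact: set_mem.
move=> /(metricType_numDomainType.nbhs_mdistP x A)[e /= e0 eA]; exists e => // y dxy.
by rewrite indicE mem_set//; exact: eA.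
Qed.

(* Lower Lipschitz envelopes h_n x = inf_y (g y + n d(x,y)). *)
Lemma lsc_approx g : (forall x, 0 <= g x <= 1) -> lsc g ->
  exists h : nat -> X -> R,
    [/\ forall n, lip01 (h n), forall n x, h n x <= g x &
        forall x, h n x @[n --> \oo] --> g x].
Proof.
move=> g01 lg.
pose S n x := [set g y + n%:R * d x y | y in [set: X]].
have S0 n x : S n x !=set0 by exists (g x + n%:R * d x x), x.
have lb n x : lbound (S n x) 0.
  move=> _ [y _ <-]; apply: addr_ge0; first by case/andP: (g01 y).
  by rewrite mulr_ge0 ?mdist_ge0.
have hS n x y : inf (S n x) <= g y + n%:R * d x y.
  by apply: ge_inf; [exists 0|exists y].
have hg n x : inf (S n x) <= g x.
  by have := hS n x x; rewrite mdistxx mulr0 addr0.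
exists (fun n x => inf (S n x)); split => //.
- move=> n; split.
    move=> x; rewrite lb_le_inf//= (le_trans (hg n x))//.
    by case/andP: (g01 x).
  exists n%:R => x y.
  have H u v : inf (S n u) <= inf (S n v) + n%:R * d u v.
    rewrite -lerBlDr; apply: lb_le_inf => // _ [w _ <-].
    rewrite lerBlDr (le_trans (hS n u w))// -addrA lerD2l -mulrDr ler_wpM2l//.
    by rewrite addrC metric_triangle.
  have := H x y; have := H y x; rewrite (metric_sym y x) => H1 H2.
  by rewrite ler_norml; apply/andP; split; lra.
- move=> x; apply/cvgrPdist_lt => e e0.
  (* Within distance [r], [g] exceeds [g x - e / 2]; beyond it, once [n] is at least [r^-1], the
     penalty alone is at least 1, hence at least [g x]. *)
  have [r r0 Hr] := lg x (g x - e / 2) ltac:(lra).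
  have : \forall n \near \oo, r^-1 <= (n%:R : R) by exact: nbhs_infty_ger.
  apply: filterS => n nd; rewrite ger0_norm ?subr_ge0//.
  suff : g x - e / 2 <= inf (S n x) by lra.
  apply: lb_le_inf => // _ [y _ <-].
  have [xy|xy] := ltP (d x y) r.
    have := Hr y xy; have : 0 <= n%:R * d x y by rewrite mulr_ge0 ?mdist_ge0.
    lra.
  have : 1 <= n%:R * d x y.
    rewrite [leLHS](_ : 1 = r^-1 * r); last by rewrite mulVf// gt_eqF.
    by apply: (@ler_pM R); [rewrite invr_ge0 ltW|exact: ltW|exact: nd|exact: xy].
  have := g01 x; have := g01 y; lra.
Qed.

(** * Portmanteau theorem along an arbitrary filter *)

Section portmanteau.
Context {T : Type} (F : set_system T) {FF : Filter F}.
Variables (m : T -> fmeasure X R) (nu : fmeasure X R).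
Hypothesis mnu : forall f, lip01 f -> mean (m t) f @[t --> F] --> mean nu f.

(** A single Lipschitz envelope [h N <= g] already has [nu]-mean above [a], and its means along [F]
    converge. *)
Lemma portmanteau_lsc g : bounded_borel g -> (forall x, 0 <= g x <= 1) -> lsc g ->
  forall a, a < mean nu g -> \forall t \near F, a < mean (m t) g.
Proof.
move=> bg g01 lg a ag.
have [h [lh hg hcv]] := lsc_approx g01 lg.
have [_ hcvg] := @mean_dct _ _ nu h g 1 (fun n => lip01_bb (lh n))
  (fun n x => ltac:(have [H _] := lh n; have /andP[h0 h1] := H x; rewrite ger0_norm//)) hcv.
have [N _ /(_ N (leqnn _)) aN] := cvgr_gt _ hcvg _ ag.
apply: filterS (cvgr_gt _ (mnu (lh N)) _ aN) => t aht; apply: (lt_le_trans aht).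
by apply: le_mean; [exact: lip01_bb|exact: bg|exact: hg].
Qed.

Hypothesis pm : forall t, is_prob (m t).
Hypothesis pn : is_prob nu.

(** Lower semicontinuity of both [g] and [1 - g] bounds the means from below and from above. *)
Lemma portmanteau01 g : continuous g -> (forall x, 0 <= g x <= 1) ->
  mean (m t) g @[t --> F] --> mean nu g.
Proof.
move=> cg g01; have bg : bounded_borel g by apply/bc_bb; split => //; exact: bounded01.
have cg' : continuous (fun x => 1 - g x).
  by move=> x; apply: cvgB; [exact: cvg_cst|exact: cg].
have g01' x : 0 <= 1 - g x <= 1 by have := g01 x; lra.
have bg' : bounded_borel (fun x => 1 - g x) by apply/bc_bb; split => //; exact: bounded01.
apply/cvgrPdist_lt => e e0.
have H1 := portmanteau_lsc bg g01 (cts_lsc cg) (a := mean nu g - e) ltac:(lra).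
have H2 := portmanteau_lsc bg' g01' (cts_lsc cg')
   (a := mean nu (fun x => 1 - g x) - e) ltac:(lra).
apply: filterS2 H1 H2 => t; rewrite !meanB ?mean_cst//; try exact: bb_cst.
by move=> H1 H2; rewrite ltr_norml; lra.
Qed.

Lemma portmanteau g : bounded_continuous g -> mean (m t) g @[t --> F] --> mean nu g.
Proof.
move=> [[M gM] cg].
(* The summand 1 keeps [K] positive, so that [g] can be rescaled affinely to a function with values
   in [0,1]. *)
pose K := `|M| + 1; have K0 : 0 < K by rewrite /K ltr_wpDl.
have gK x : `|g x| <= K by rewrite (le_trans (gM x))// /K (le_trans (ler_norm M))// lerDl.
pose h x := (2 * K)^-1 * (g x + K).
have ch : continuous h.
  move=> x; apply: cvgM; first exact: cvg_cst.
  by apply: cvgD; [exact: cg|exact: cvg_cst].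
have h01 x : 0 <= h x <= 1.
  have /ler_normlP[g1 g2] := gK x.
  rewrite /h mulr_ge0/= ?invr_ge0; [|lra|lra].
  by rewrite mulrC ler_pdivrMr; lra.
have bh : bounded_borel h by apply/bc_bb; split => //; exact: bounded01.
have gE : g = fun x => 2 * K * h x - K.
  by apply/funext => x; rewrite /h mulVKf ?addrK// gt_eqF//; lra.
have mE mu : is_prob mu -> mean mu g = 2 * K * mean mu h - K.
  move=> pmu; rewrite {1}gE meanB; [|exact: bbZ|exact: bb_cst].
  by rewrite meanZ// mean_cst.
rewrite mE//; under eq_fun do rewrite mE//.
apply: cvgB; last exact: cvg_cst.
by apply: cvgM; [exact: cvg_cst|exact: portmanteau01].
Qed.

End portmanteau.

(** The portmanteau inequality for a constant sequence, used in both directions, gives equality on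
    open sets, a generating family closed under intersection. *)
Lemma measure_eq_lip mu nu : is_prob mu -> is_prob nu ->
  (forall f, lip01 f -> mean mu f = mean nu f) ->
  forall A, measurable (A : set (borel X)) -> mu A = nu A.
Proof.
move=> pm pn mn A mA.
have le m1 m2 : (forall f, lip01 f -> mean m1 f = mean m2 f) ->
    forall B, open B -> mean m2 (\1_B) <= mean m1 (\1_B).
  move=> m12 B oB; rewrite leNgt; apply/negP => lt.
  have b01 x : 0 <= (\1_B x : R) <= 1 by rewrite indicE; case: (x \in B); rewrite /= ?lexx ?ler01.
  have cv f : lip01 f -> mean m1 f @[_ --> \oo] --> mean m2 f.
    by move=> lf; rewrite m12//; exact: cvg_cst.
  have := @portmanteau_lsc nat \oo _ (fun=> m1) m2 cv _
    (bb_indic (open_borel oB)) b01 (open_lsc oB) _ lt.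
  by move=> [N _ /(_ N (leqnn _))] /=; rewrite ltxx.
apply: (@measure_unique _ R (borel X) (@open X) (fun=> setT)) => //.
- by move=> B C; exact: openI.
- by move=> _; exact: openT.
- by apply/seteqP; split => // x _; exists 0%N.
- move=> B oB.
  apply: etrans (measure_mean mu (open_borel oB)) _.
  apply: etrans _ (esym (measure_mean nu (open_borel oB))).
  congr EFin; apply/eqP; rewrite eq_le !le//.
  by move=> f lf; rewrite mn.
- move=> _; have : (mu [set: borel X] < +oo)%E by rewrite (pm : mu _ = _) ltry.
  exact.
Qed.

End lipschitz.

(** * Merging of orbits *)

Section semigroup.
Context {R : realType} {X : pmetricType R}.
Context {Pm : R -> fmeasure X R -> fmeasure X R} {Pf : R -> (X -> R) -> (X -> R)}.
Hypothesis MF : markov_feller Pm Pf.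
Implicit Types (mu nu : fmeasure X R) (f g : X -> R) (A B : set X) (x y z : X)
  (s t : R).
Local Notation d := (@mdist R X).

Definition law t x : fmeasure X R := Pm t (\d_(x : borel X)).

Lemma Pm_prob t mu : 0 <= t -> is_prob mu -> is_prob (Pm t mu).
Proof. by case: MF => H _ _ _ _ t0 pm; rewrite /is_prob H. Qed.

Lemma dirac_prob x : is_prob (\d_(x : borel X) : fmeasure X R).
Proof. exact: diracT. Qed.

Lemma law_prob t x : 0 <= t -> is_prob (law t x).
Proof. by move=> t0; apply: Pm_prob => //; exact: dirac_prob. Qed.

Lemma Pf_bb t f : 0 <= t -> bounded_borel f -> bounded_borel (Pf t f).
Proof. by case: MF => _ _ _ [H _] _ t0 bf; case: (H t f t0 bf). Qed.

Lemma mean_Pm t mu f : 0 <= t -> bounded_borel f ->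
  mean (Pm t mu) f = mean mu (Pf t f).
Proof. by case: MF => _ _ _ [H _] _ t0 bf; rewrite /mean (H t f t0 bf).2. Qed.

Lemma mean_dirac x f : bounded_borel f -> mean (\d_(x : borel X)) f = f x.
Proof.
move=> bf; rewrite /mean /integ integral_dirac//; last first.
  by have /integrableP[] := bb_integrable (\d_(x : borel X)) bf.
by rewrite diracT mul1e.
Qed.

Lemma mean_law t x f : 0 <= t -> bounded_borel f -> mean (law t x) f = Pf t f x.
Proof. by move=> t0 bf; rewrite mean_Pm// mean_dirac//; exact: Pf_bb. Qed.

(** The semigroup law is assumed on measures; testing it on Dirac masses transfers it to the dual
    operators. *)
Lemma Pf_add s t f : 0 <= s -> 0 <= t -> bounded_borel f ->
  Pf (s + t) f = Pf s (Pf t f).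
Proof.
move=> s0 t0 bf; apply/funext => x.
rewrite -mean_law ?addr_ge0// -[RHS]mean_law//; last exact: Pf_bb.
rewrite -mean_Pm//; apply: eq_mean => A mA.
by case: MF => _ _ [_ H] _ _; rewrite H.
Qed.

Lemma Pf_cts t f : 0 <= t -> bounded_continuous f -> continuous (Pf t f).
Proof. by case: MF => _ _ _ _ H t0; exact: H. Qed.

Lemma Pf01 t f : 0 <= t -> bounded_borel f -> (forall x, 0 <= f x <= 1) ->
  forall x, 0 <= Pf t f x <= 1.
Proof.
move=> t0 bf f01 x; rewrite -mean_law//.
rewrite -{1}(@mean_cst _ _ (law t x) 0 (law_prob x t0)).
rewrite -(@mean_cst _ _ (law t x) 1 (law_prob x t0)).
by rewrite !le_mean//; try exact: bb_cst; move=> y; case/andP: (f01 y).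
Qed.

(** Reverse Fatou lemma for a two-valued asymptotic bound, phrased with eventual inequalities so
    that no limsup of real sequences is needed. [osc_step] applies it once to each starting
    point. *)
Lemma reverse_fatou mu B (a b M : R) (k : nat -> X -> R) : is_prob mu ->
  measurable (B : set (borel X)) ->
  (forall n, bounded_borel (k n)) -> (forall n x, `|k n x| <= M) ->
  (forall x, B x -> forall e, 0 < e -> \forall n \near \oo, k n x <= a + e) ->
  (forall x, ~ B x -> forall e, 0 < e -> \forall n \near \oo, k n x <= b + e) ->
  forall e, 0 < e -> \forall n \near \oo,
    mean mu (k n) <= b + (a - b) * mean mu (\1_B) + e.
Proof.
move=> pm mB bk kM ka kb e e0.
pose c x : R := b + (a - b) * \1_B x.
have bi := bb_indic mB.
have bc : bounded_borel c by apply: bbD; [exact: bb_cst|exact: bbZ].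
(* Dominated convergence, applied to the positive part of k n - c. *)
pose w n x := Num.max (k n x - c x) 0.
have bw n : bounded_borel (w n).
  by apply: bb_max; [exact: bbB|exact: bb_cst].
have w_ge0 n x : 0 <= w n x by rewrite /w le_max lexx orbT.
have cM x : `|c x| <= `|a| + `|b|.
  rewrite /c indicE; case: (x \in B) => /=; rewrite ?mulr1 ?mulr0 ?addr0 ?lerDr//.
  by rewrite [b + _]addrC subrK lerDl.
have [_ /cvgrPdist_lt/(_ e e0)] : bounded_borel (fun _ : X => 0 : R) /\
    mean mu (w n) @[n --> \oo] --> mean mu (fun=> 0).
  apply: (@mean_dct _ _ _ _ _ (M + (`|a| + `|b|))) => //.
    move=> n x; rewrite ger0_norm// /w ge_max; apply/andP; split.
      have := kM n x; have := cM x; rewrite !ler_norml; lra.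
    by rewrite (le_trans (normr_ge0 (k n x)))// (le_trans (kM n x))// lerDl addr_ge0.
  move=> x; apply/cvgrPdist_lt => r r0.
  have : \forall n \near \oo, k n x <= c x + r / 2.
    have r20 : 0 < r / 2 by lra.
    rewrite /c indicE; have [xB|xB] := boolP (x \in B) => /=.
      apply: filterS (ka x (set_mem xB) _ r20) => n.
      by rewrite mulr1 [b + _]addrC subrK.
    apply: filterS (kb x _ _ r20) => [n|]; first by rewrite mulr0 addr0.
    by rewrite notin_setE in xB.
  apply: filterS => n kn; rewrite sub0r normrN ger0_norm// /w gt_max.
  by apply/andP; split; lra.
apply: filterS => n; rewrite mean_cst// sub0r normrN => wn.
have := le_lt_trans (ler_norm _) wn => {}wn.
have : mean mu (k n) <= mean mu (fun x => c x + w n x).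
  apply: le_mean; [exact: bk|exact: bbD|] => x.
  by rewrite -lerBlDl /w le_max lexx.
rewrite meanD// /c meanD ?meanZ ?mean_cst//; [lra|exact: bb_cst|exact: bbZ].
Qed.

(** The number [c] bounds the asymptotic oscillation. Times run along sequences because dominated
    convergence is sequential; no absolute value is needed since [x] and [y] can be exchanged. *)
Definition osc f (c : R) := forall (t : nat -> R),
  t n @[n --> \oo] --> +oo -> forall x y e, 0 < e ->
  \forall n \near \oo, Pf (t n) f x - Pf (t n) f y <= c + e.

(* Run both starting points up to a time s at which each has mass at least b in B. *)
Lemma osc_step f B (a b c : R) : lip01 f -> measurable (B : set (borel X)) ->
  0 <= a -> a <= c -> 0 <= b ->
  (forall (t : nat -> R), t n @[n --> \oo] --> +oo -> forall x y, B x -> B y ->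
     forall e, 0 < e -> \forall n \near \oo, Pf (t n) f x - Pf (t n) f y <= a + e) ->
  (forall x y, exists2 s, 0 <= s & b <= mean (law s x) (\1_B) /\
                                   b <= mean (law s y) (\1_B)) ->
  osc f c -> osc f (c - b ^+ 2 * (c - a)).
Proof.
move=> lf mB a0 ac b0 Ba Bb oc t too x y e e0.
have bf := lip01_bb lf.
have [s s0 [bx by_]] := Bb x y.
(* The remaining time after [s], truncated so that it is admissible for every [n]; the truncation is
   eventually void. *)
pose u n := Num.max 0 (t n - s).
have u0 n : 0 <= u n by rewrite /u le_max lexx.
have uoo : u n @[n --> \oo] --> +oo.
  apply/cvgryPge => M; apply: filterS (cvgry_ge too (M + s)) => n Mn.
  by rewrite /u le_max; apply/orP; right; lra.
pose g n := Pf (u n) f.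
have bg n : bounded_borel (g n) by exact: Pf_bb.
have g01 n v : 0 <= g n v <= 1 by apply: Pf01 => //; case: lf.
have tu : \forall n \near \oo, Pf (t n) f = Pf s (g n).
  apply: filterS (cvgry_ge too s) => n sn.
  by rewrite /g -Pf_add//; congr Pf; rewrite /u max_r; lra.
have mg n v : 0 <= mean (law s v) (g n) <= 1.
  by rewrite mean_law//; apply: Pf01.
(* Average over the second starting point first, with the first one frozen at [v]. It will be used
   with [a' = a] when [v] is in [B], and with [a' = c], where the gain vanishes, otherwise. *)
have inner v (a' : R) : a' <= c ->
  (forall w, B w -> forall e, 0 < e -> \forall n \near \oo, g n v - g n w <= a' + e) ->
  forall e, 0 < e -> \forall n \near \oo,
    g n v - mean (law s y) (g n) <= c - (c - a') * b + e.
  move=> ac' Hv r r0.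
  have := @reverse_fatou (law s y) B a' c 1 (fun n w => g n v - g n w) (law_prob y s0) mB
    (fun n => bbB (bb_cst _) (bg n)) _ Hv (fun w _ => oc u uoo v w) r r0.
  have H n w : `|g n v - g n w| <= 1.
    by have := g01 n v; have := g01 n w; rewrite ler_norml; lra.
  move=> /(_ H); apply: filterS => n.
  rewrite meanB ?mean_cst//; [|exact: law_prob|exact: bb_cst].
  move=> /le_trans; apply; nra.
(* Then average over the first starting point: the inner gain [(c - a) * b] occurs on [B], of mass
   at least [b], whence the factor [b ^+ 2]. *)
have := @reverse_fatou (law s x) B (c - (c - a) * b) c 1 (fun n v => g n v - mean (law s y) (g n))
  (law_prob x s0) mB (fun n => bbB (bg n) (bb_cst _)) _ _ _ e e0.
have H1 n w : `|g n w - mean (law s y) (g n)| <= 1.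
  by have := g01 n w; have := mg n y; rewrite ler_norml; lra.
have H2 v : B v -> forall e, 0 < e -> \forall n \near \oo,
    g n v - mean (law s y) (g n) <= c - (c - a) * b + e.
  by move=> Bv; apply: inner => // w Bw; exact: (Ba u uoo).
have H3 v : ~ B v -> forall e, 0 < e -> \forall n \near \oo,
    g n v - mean (law s y) (g n) <= c + e.
  move=> _ r r0; have := @inner v c (lexx _) (fun w _ => oc u uoo v w) r r0.
  by apply: filterS => n; rewrite subrr mul0r subr0.
move=> /(_ H1 H2 H3) H; near=> n.
have En : Pf (t n) f = Pf s (g n) by near: n.
rewrite En -!mean_law//.
have : mean (law s x) (fun v => g n v - mean (law s y) (g n)) <=
  c + (c - (c - a) * b - c) * mean (law s x) (\1_B) + e by near: n.
rewrite meanB ?mean_cst//; [|exact: law_prob|exact: bb_cst].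
move=> /le_trans; apply; rewrite lerD2r.
have : 0 <= (c - a) * b by rewrite mulr_ge0// subr_ge0.
nra.
Unshelve. all: by end_near. Qed.

End semigroup.

Section merging.
Context {R : realType} {X : pmetricType R}.
Context {Pm : R -> fmeasure X R -> fmeasure X R} {Pf : R -> (X -> R) -> (X -> R)}.
Hypothesis MF : markov_feller Pm Pf.
Implicit Types (mu nu : fmeasure X R) (f g : X -> R) (A B : set X) (x y z : X)
  (s t : R).
Local Notation d := (@mdist R X).
Local Notation law := (@law R X Pm).

(** Any real strictly below the infimum serves as [b]. It is common to all starting points, whereas
    the time threshold may depend on [x]. *)
Lemma lower_boundP z e : lower_bound_cond Pm z -> 0 < e ->
  exists2 b : R, 0 < b & forall x,
    \forall t \near +oo, b <= mean (law t x) (\1_(ball z e)).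
Proof.
move=> lb e0; have := lb e e0.
set I := ereal_inf _ => I0.
have [b b0 bI] : exists2 b : R, 0 < b & (b%:E < I)%E.
  case: I I0 => [r|_|//].
  - rewrite lte_fin => r0; exists (r / 2); [lra|rewrite lte_fin; lra].
  - by exists 1; rewrite ?ltry.
exists b => // x.
have : (b%:E < limf_einf (fun t => trans Pm t x (ball z e)) (pinfty_nbhs R))%E.
  by apply: lt_le_trans bI _; apply: ereal_inf_lbound; exists x.
rewrite limf_einfE => /ereal_sup_gt[_ [V oV <-]] bV.
apply: filterS oV => t Vt.
have mB : measurable (ball z e : set (borel X)) by exact: ball_borel.
rewrite -lee_fin -measure_mean//.
by apply: (le_trans (ltW bV)); apply: ereal_inf_lbound; exists t.
Qed.

Lemma eventually_continuousP z f e : eventually_continuous_at Pf z ->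
  bounded_lipschitz f -> 0 < e ->
  exists2 r : R, 0 < r & forall x, ball z r x ->
    \forall t \near +oo, `|Pf t f x - Pf t f z| < e.
Proof.
move=> ec lf e0; have : (limf_esup (fun x => limf_esup (fun t => (`|Pf t f x - Pf t f z|)%:E)
    (pinfty_nbhs R)) (nbhs z) < e%:E)%E by rewrite ec// lte_fin.
rewrite limf_esupE => /ereal_inf_lt[_ [V Vz <-]] Ve.
have [r r0 rV] := (metricType_numDomainType.nbhs_mdistP z V).1 Vz.
exists r => // x; rewrite ballEmdist => zx.
have : (limf_esup (fun t => (`|Pf t f x - Pf t f z|)%:E) (pinfty_nbhs R) < e%:E)%E.
  by apply: le_lt_trans Ve; apply: ereal_sup_ubound; exists x => //; exact: rV.
rewrite limf_esupE => /ereal_inf_lt[_ [W Woo <-]] We.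
apply: filterS Woo => t Wt; rewrite -lte_fin; apply: le_lt_trans We.
by apply: ereal_sup_ubound; exists t.
Qed.

Section hyps.
Variable z : X.
Hypotheses (ECz : eventually_continuous_at Pf z) (LBz : lower_bound_cond Pm z).

(** The least bound above [2 * h] is improved by [osc_step] unless it equals [2 * h]; then [h] tends
    to 0. *)
Lemma osc0 f : lip01 f -> osc (Pf := Pf) f 0.
Proof.
move=> lf.
(* The factor 2 arises because two orbits started in the ball are compared through the orbit of [z],
   each at asymptotic distance less than [h] from it. *)
suff H (h : R) : 0 < h -> osc (Pf := Pf) f (2 * h).
  move=> t too x y e e0; have := H (e / 4) ltac:(lra) t too x y (e / 2) ltac:(lra).
  by apply: filterS => n; lra.
move=> h0.
have [r r0 rh] := eventually_continuousP ECz (lip01_bl lf) h0.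
have [b b0 Hb] := lower_boundP LBz r0.
have mB : measurable (ball z r : set (borel X)) by exact: ball_borel.
have bS x y : exists2 s, 0 <= s & b <= mean (law s x) (\1_(ball z r)) /\
                                  b <= mean (law s y) (\1_(ball z r)).
  have p0 : \forall t \near +oo, (0 : R) <= t by exact: nbhs_pinfty_ge.
  have H : \forall t \near +oo, [/\ 0 <= t, b <= mean (law t x) (\1_(ball z r)) &
      b <= mean (law t y) (\1_(ball z r))].
    by apply: filterS3 p0 (Hb x) (Hb y) => t; split.
  by have [s [s0 ? ?]] := filter_ex H; exists s.
have b1 : b <= 1.
  have [s s0 [bs _]] := bS z z; apply: (le_trans bs).
  rewrite -(@mean_cst _ _ (law s z) 1 (law_prob MF z s0)); apply: le_mean.
  - exact: bb_indic.
  - exact: bb_cst.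
  - by move=> y; rewrite indicE; case: (y \in _).
have close (t : nat -> R) : t n @[n --> \oo] --> +oo -> forall x y,
     ball z r x -> ball z r y ->
     forall e, 0 < e -> \forall n \near \oo, Pf (t n) f x - Pf (t n) f y <= 2 * h + e.
  move=> too x y zx zy e e0.
  have Hx : \forall n \near \oo, `|Pf (t n) f x - Pf (t n) f z| < h := too _ (rh x zx).
  have Hy : \forall n \near \oo, `|Pf (t n) f y - Pf (t n) f z| < h := too _ (rh y zy).
  by apply: filterS2 Hx Hy => n; rewrite !ltr_norml; lra.
(* Excluding bounds below [2 * h] makes [C] bounded below and ensures that [osc_step] applies to its
   infimum. *)
pose C := [set c : R | 2 * h <= c /\ osc (Pf := Pf) f c].
have lbC : lbound C (2 * h) by move=> c [].
have C0 : C !=set0.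
  exists (1 + 2 * h); split; first by lra.
  move=> t too x y e e0; apply: filterS (cvgry_ge too 0) => n tn.
  have f01 : forall x, 0 <= f x <= 1 by case: lf.
  by have := Pf01 MF tn (lip01_bb lf) f01 x; have := Pf01 MF tn (lip01_bb lf) f01 y; lra.
have iC : 2 * h <= inf C by exact: lb_le_inf.
(* The slack [e] in [osc] makes the infimum itself an admissible bound. *)
have oi : osc (Pf := Pf) f (inf C).
  move=> t too x y e e0.
  have e20 : 0 < e / 2 by lra.
  have hC : has_inf C by split => //; exists (2 * h).
  have [c [_ oc] ce] := inf_adherent e20 hC.
  have := oc t too x y (e / 2) ltac:(lra).
  by apply: filterS => n; lra.
have h20 : 0 <= 2 * h by lra.
pose c' := inf C - b ^+ 2 * (inf C - 2 * h).
have oc' : osc (Pf := Pf) f c' := osc_step MF lf mB h20 iC (ltW b0) close bS oi.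
have b21 : b ^+ 2 <= 1 by apply: exprn_ile1 => //; exact: ltW.
(* The improved bound stays in [C] because [b] is at most 1. *)
have c'h : 2 * h <= c' by rewrite /c'; move: (b ^+ 2) b21 iC => q q1 iC; nra.
have : inf C <= c' by apply: ge_inf; [exists (2 * h)|].
rewrite /c' lerBrDl gerDr => Hi.
suff -> : 2 * h = inf C by [].
apply/eqP; rewrite eq_le iC/= leNgt; apply/negP => lt.
have : 0 < b ^+ 2 * (inf C - 2 * h) by rewrite mulr_gt0 ?exprn_gt0// subr_gt0.
lra.
Qed.

Lemma merge_points f x y : lip01 f ->
  Pf t f x - Pf t f y @[t --> +oo] --> (0 : R).
Proof.
move=> lf; apply/cvg_pinftyP => u uoo; apply/cvgrPdist_lt => e e0.
have e20 : 0 < e / 2 by lra.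
apply: filterS2 (osc0 lf uoo x y e20) (osc0 lf uoo y x e20) => n H1 H2.
by rewrite sub0r normrN ltr_norml; lra.
Qed.

(** Integrate the merging of points over the initial law by dominated convergence. *)
Lemma merge_point mu f y : is_prob mu -> lip01 f ->
  mean (Pm t mu) f - Pf t f y @[t --> +oo] --> (0 : R).
Proof.
move=> pm lf; have bf := lip01_bb lf; have f01 : forall x, 0 <= f x <= 1 by case: lf.
apply/cvg_pinftyP => u uoo.
(* Dominated convergence needs bounded Borel functions at every index, hence nonnegative times
   throughout. *)
pose v n := Num.max 0 (u n).
have v0 n : 0 <= v n by rewrite /v le_max lexx.
have uv : \forall n \near \oo, v n = u n.
  by apply: filterS (cvgry_ge uoo 0) => n un; rewrite /v max_r.
have bv n : bounded_borel (Pf (v n) f) by exact: (Pf_bb MF).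
have H : mean mu (fun x => Pf (v n) f x - Pf (v n) f y) @[n --> \oo] --> mean mu (fun=> 0).
  apply: (@mean_dct _ _ mu _ _ 1 _ _ _).2.
  - by move=> n; apply: bbB => //; exact: bb_cst.
  - move=> n x; have := Pf01 MF (v0 n) bf f01 x; have := Pf01 MF (v0 n) bf f01 y.
    by rewrite ler_norml; lra.
  - move=> x; have := (cvg_pinftyP _ _).1 (merge_points x y lf) u uoo.
    apply: cvg_trans; apply: near_eq_cvg.
    by apply: filterS uv => n ->.
rewrite mean_cst// in H; apply: cvg_trans H; apply: near_eq_cvg.
apply: filterS uv => n vn; rewrite meanB ?mean_cst//; last exact: bb_cst.
by rewrite -(mean_Pm MF)// vn.
Qed.

(** Both orbits are compared with that of the point [z]. *)
Lemma merge mu nu f : is_prob mu -> is_prob nu -> lip01 f ->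
  mean (Pm t mu) f - mean (Pm t nu) f @[t --> +oo] --> (0 : R).
Proof.
move=> pm pn lf.
have -> : (fun t => mean (Pm t mu) f - mean (Pm t nu) f) =
    (fun t => (mean (Pm t mu) f - Pf t f z) - (mean (Pm t nu) f - Pf t f z)).
  by apply/funext => t; ring.
rewrite -[X in _ --> X](subr0 (0 : R)).
by apply: cvgB; exact: merge_point.
Qed.

End hyps.
End merging.

(** * Baire category and supports *)

Section polish_tools.
Context {R : realType} {X : pmetricType R}.
Implicit Types (mu nu : fmeasure X R) (f g : X -> R) (A B : set X) (x y z : X).
Local Notation d := (@mdist R X).

Definition dense_seq (c : nat -> X) := forall x e, 0 < e -> exists i, d (c i) x < e.

Lemma separable_seq : separable (X := X) -> exists c, dense_seq c.
Proof.
move=> [D [/countable_injP[h hinj] dD]].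
(* Inverts an injection of [D] into the naturals; indices outside its image receive the default
   [point], which does not hurt density. *)
exists (fun n => xget point [set y | D y /\ h y = n]) => x e e0.
have [y [xy Dy]] : (ball x e) `&` D !=set0.
  apply: dD; last exact: open_mball.
  by exists x; exact: ballxx.
exists (h y); case: xgetP => [w _ [Dw hw]|/(_ y)]; last by case.
have -> : w = y by apply: hinj; rewrite ?inE.
by move: xy; rewrite ballEmdist /= metric_sym.
Qed.

Lemma complete_seq (u : nat -> X) : complete_metric (X := X) ->
  (forall e, 0 < e -> exists N, forall m n, (N <= m)%N -> (N <= n)%N -> d (u m) (u n) < e) ->
  exists l, forall e, 0 < e -> exists N, forall n, (N <= n)%N -> d (u n) l < e.
Proof.
move=> cX cu.
have [l ul] : exists l : X, u @ \oo --> l.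
  apply: cX; apply/cauchy_ballP => e e0.
  have [N HN] := cu e e0.
  exists (u @` [set n | (N <= n)%N], u @` [set n | (N <= n)%N]).
    by split; exists N => // n Nn; exists n.
  move=> [_ _] /= [[m Nm <-] [n Nn <-]].
  by rewrite ballEmdist /=; exact: HN.
exists l => e e0.
have [N _ HN] := metricType_numDomainType.cvgr_dist_lt ul e0.
by exists N => n Nn; rewrite metric_sym; exact: HN.
Qed.

(** Baire's theorem in the closed subset [F], without forming a subspace: relative density of [O n]
    is expressed by points of [F]. The proof shrinks balls centred in [F]. *)
Lemma baire_rel (F : set X) (O : nat -> set X) : complete_metric (X := X) ->
  closed F -> F !=set0 -> (forall n, open (O n)) ->
  (forall n x r, F x -> 0 < r -> exists y, [/\ F y, ball x r y & O n y]) ->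
  exists y, F y /\ forall n, O n y.
Proof.
move=> cX cF [x0 Fx0] oO dO.
(* A pair is a centre and a radius. The premises sit inside the existential so that [choice] yields
   a total function. *)
have step n (p : X * R) : exists q : X * R, F p.1 -> 0 < p.2 ->
  [/\ F q.1, 0 < q.2, q.2 <= p.2 / 2, d p.1 q.1 + q.2 <= p.2 &
    forall y, d q.1 y <= q.2 -> O n y].
  have [[Fp p0]|np] := pselect (F p.1 /\ 0 < p.2); last first.
    by exists p => Fp p0; case: np.
  have [y [Fy xy Oy]] := dO n p.1 p.2 Fp p0.
  have [r /= r0 rO] := (metricType_numDomainType.nbhs_mdistP y (O n)).1
    (open_nbhs_nbhs (conj (oO n) Oy)).
  move: xy; rewrite ballEmdist /= => xy.
  (* The three terms put the closed ball inside [O n], halve the radius, and nest the new ball in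
     the old one. *)
  exists (y, Num.min (r / 2) (Num.min (p.2 / 2) (p.2 - d p.1 y))) => _ _; split => //=.
  - by rewrite !lt_min; apply/and3P; split; lra.
  - by rewrite !ge_min lexx orbT.
  - by rewrite -lerBrDl !ge_min lexx !orbT.
  - move=> w; rewrite !le_min => /andP[yw _]; apply: rO => /=; lra.
have [q Hq] := choice (fun np : nat * (X * R) => step np.1 np.2).
pose s := fix s n := if n is n'.+1 then q (n', s n') else (x0, 1).
have sP n : F (s n).1 /\ 0 < (s n).2.
  by elim: n => [//|n [IH1 IH2]]; have [] := Hq (n, s n) IH1 IH2.
have sS n : [/\ (s n.+1).2 <= (s n).2 / 2, d (s n).1 (s n.+1).1 + (s n.+1).2 <= (s n).2
    & forall y, d (s n.+1).1 y <= (s n.+1).2 -> O n y].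
  by have [H1 H2] := sP n; have [] := Hq (n, s n) H1 H2.
have nest k n : d (s n).1 (s (n + k)%N).1 + (s (n + k)%N).2 <= (s n).2.
  elim: k => [|k IH]; first by rewrite addn0 mdistxx add0r.
  have [_ H _] := sS (n + k)%N; rewrite addnS.
  have := metric_triangle (s n).1 (s (n + k)%N).1 (s (n + k).+1).1; lra.
have s2 n : (s n).2 <= n.+1%:R^-1.
  suff : (s n).2 <= (2 ^+ n)^-1.
    move=> /le_trans; apply; rewrite lef_pV2 ?posrE ?exprn_gt0//.
    by rewrite -natrX ler_nat ltn_expl.
  elim: n => [|n IH]; first by rewrite expr0 invr1.
  have [H _ _] := sS n; rewrite exprS invfM; lra.
have small e : 0 < e -> exists N, (s N).2 < e.
  move=> e0; have [N _ /(_ N (leqnn _)) HN] := near_infty_natSinv_lt (PosNum e0).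
  by exists N; apply: (le_lt_trans (s2 N)).
have [l Hl] : exists l, forall e, 0 < e -> exists N, forall n, (N <= n)%N -> d (s n).1 l < e.
  apply: complete_seq => // e e0; have [N HN] := small (e / 2) ltac:(lra).
  exists N => m n Nm Nn.
  have Hm := nest (m - N)%N N; have Hn := nest (n - N)%N N.
  rewrite !subnKC// in Hm Hn.
  have := metric_triangle (s m).1 (s N).1 (s n).1.
  rewrite (metric_sym (s m).1 (s N).1).
  have := (sP m).2; have := (sP n).2; lra.
have lim n : d (s n).1 l <= (s n).2.
  apply/ler_addgt0Pr => e e0; have [N HN] := Hl e e0.
  have := HN (n + N)%N (leq_addl _ _); have := nest N n; have := (sP (n + N)%N).2.
  have := metric_triangle (s n).1 (s (n + N)%N).1 l; lra.
exists l; split; last by move=> n; have [_ _] := sS n; apply; exact: lim.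
apply: cF => B /(metricType_numDomainType.nbhs_mdistP l B)[e /= e0 eB].
have [N HN] := Hl e e0; exists (s N).1; split; first exact: (sP N).1.
by apply: eB; rewrite /= metric_sym HN.
Qed.

Section dense.
Variable c : nat -> X.
Hypothesis dc : dense_seq c.

(** A locally null set is covered by the countably many null balls with centre [c i] and radius
    [j.+1%:R^-1]. *)
Lemma null_local mu A :
  (forall x, A x -> exists2 e, 0 < e & mu (ball x e) = 0%E) -> mu.-negligible A.
Proof.
move=> A0.
pose G i j := if `[< mu (ball (c i) j.+1%:R^-1) = 0%E >] then ball (c i) j.+1%:R^-1 else set0.
have nG i j : mu.-negligible (G i j).
  rewrite /G; case: asboolP => H; last exact: negligible_set0.
  by apply/negligibleP => //; exact: ball_borel.
apply: (@negligibleS _ (borel X) R mu (\bigcup_i \bigcup_j G i j)).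
  move=> x Ax; have [e e0 xe] := A0 x Ax.
  (* With radius below [e / 2], a ball of the family that contains [x] lies inside [ball x e]. *)
  have [j _ /(_ j (leqnn _)) je] := near_infty_natSinv_lt (PosNum (divr_gt0 e0 (ltr0n R 2))).
  have j0 : (0 : R) < j.+1%:R^-1 by rewrite invr_gt0.
  have [i ix] := dc x j0.
  exists i => //; exists j => //; rewrite /G; case: asboolP => [_|]; first by rewrite ballEmdist.
  case; apply/eqP; rewrite -measure_le0 -xe; apply: le_measure.
  - by rewrite inE; exact: ball_borel.
  - by rewrite inE; exact: ball_borel.
  - rewrite !ballEmdist => y /= iy.
    have := metric_triangle x (c i) y; rewrite (metric_sym x (c i)).
    have : j.+1%:R^-1 < e / 2 := je.
    move: iy ix; set q := j.+1%:R^-1; lra.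
by apply: negligible_bigcup => i; exact: negligible_bigcup.
Qed.

(** With empty support the whole space would be locally null, hence null. *)
Lemma support_point mu : is_prob mu -> exists x, forall e, 0 < e -> mu (ball x e) <> 0%E.
Proof.
move=> pm; apply: contrapT => /forallNP H.
have [N [mN N0 TN]] : mu.-negligible [set: borel X].
  apply: null_local => x _; have /existsNP[e /not_implyP[e0 /contrapT xe]] := H x.
  by exists e.
have NT : N = setT by apply/seteqP; split => // x _; exact: TN.
by move: N0; rewrite NT (pm : mu _ = _) => /eqP; rewrite onee_eq0.
Qed.

(** A Lipschitz bump around [y]: it equals 1 up to distance [a] and vanishes from distance [2 * a]
    on. *)
Definition tent (a : R) y x : R := Num.max 0 (Num.min 1 (2 - a^-1 * d y x)).

(** A Lipschitz substitute for the indicator of the union of the first [J] balls of radius [a];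
    tightness is expressed through these functions rather than through compact sets. *)
Fixpoint cover_fun (a : R) J x : R :=
  if J is J'.+1 then Num.max (cover_fun a J' x) (tent a (c J') x) else 0.

Lemma tent01 a y x : 0 <= tent a y x <= 1.
Proof. by rewrite /tent le_max lexx /= ge_max ler01/= ge_min lexx. Qed.

Lemma cover01 a J x : 0 <= cover_fun a J x <= 1.
Proof.
elim: J => [|J /andP[IH1 IH2]] /=; first by rewrite lexx ler01.
by have /andP[t0 t1] := tent01 a (c J) x; rewrite le_max IH1/= ge_max IH2.
Qed.

Lemma tent_lip a y x x' : 0 < a -> `|tent a y x - tent a y x'| <= a^-1 * d x x'.
Proof.
move=> a0; have i0 : 0 < a^-1 by rewrite invr_gt0.
have H1 := metric_triangle y x x'; have H2 := metric_triangle y x' x.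
rewrite (metric_sym x' x) in H2.
have h1 : a^-1 * d y x' <= a^-1 * d y x + a^-1 * d x x' by rewrite -mulrDr ler_pM2l.
have h2 : a^-1 * d y x <= a^-1 * d y x' + a^-1 * d x x' by rewrite -mulrDr ler_pM2l.
have h3 : 0 <= a^-1 * d x x' by rewrite mulr_ge0 ?mdist_ge0// ltW.
have clamp (u v r : R) : u <= v + r -> 0 <= r ->
    Num.max 0 (Num.min 1 u) <= Num.max 0 (Num.min 1 v) + r.
  move=> uv r0; rewrite ge_max addr_ge0 ?le_max ?lexx//=.
  have [v1|v1] := leP 1 v; first by rewrite max_r// (@le_trans _ _ 1) ?ge_min ?lexx// lerDl.
  have [v0|v0] := leP 0 v; rewrite ge_min; apply/orP; right; lra.
have := clamp (2 - a^-1 * d y x) (2 - a^-1 * d y x') (a^-1 * d x x') ltac:(lra) h3.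
have := clamp (2 - a^-1 * d y x') (2 - a^-1 * d y x) (a^-1 * d x x') ltac:(lra) h3.
by rewrite /tent ler_norml => ? ?; apply/andP; split; lra.
Qed.

Lemma cover_lip a J x x' : 0 < a ->
  `|cover_fun a J x - cover_fun a J x'| <= a^-1 * d x x'.
Proof.
move=> a0; elim: J => [|J IH] /=.
  by rewrite subrr normr0 mulr_ge0 ?mdist_ge0// invr_ge0 ltW.
by rewrite (le_trans (ler_norm_max _ _ _ _))// ge_max IH tent_lip.
Qed.

Lemma cover_lip01 a J : 0 < a -> lip01 (cover_fun a J).
Proof. by move=> a0; split; [exact: cover01|exists a^-1 => x y; exact: cover_lip]. Qed.

Lemma cover_mono a I J x : (I <= J)%N -> cover_fun a I x <= cover_fun a J x.
Proof.
move=> /subnKC <-; elim: (J - I)%N => [|k IH]; first by rewrite addn0.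
by rewrite addnS /= le_max IH.
Qed.

Lemma cover_eq1 a J x i : 0 < a -> (i < J)%N -> d (c i) x <= a -> cover_fun a J x = 1.
Proof.
move=> a0 iJ ix; apply/eqP; rewrite eq_le; have /andP[_ ->] := cover01 a J x => /=.
apply: le_trans (cover_mono a x iJ) => /=; rewrite le_max /tent; apply/orP; right.
rewrite le_max le_min lexx /=; apply/orP; right.
have : a^-1 * d (c i) x <= 1 by rewrite mulrC ler_pdivrMr// mul1r.
lra.
Qed.

Lemma cover_gt0 a J x : 0 < a -> 0 < cover_fun a J x ->
  exists2 i, (i < J)%N & d (c i) x <= 2 * a.
Proof.
move=> a0; elim: J => [|J IH] /=; first by rewrite ltxx.
rewrite lt_max => /orP[/IH[i iJ ix]|]; first by exists i => //; exact: ltnW.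
rewrite /tent lt_max ltxx /= lt_min => /andP[_ H]; exists J => //.
have : a^-1 * d (c J) x < 2 by lra.
by rewrite mulrC ltr_pdivrMr// => /ltW.
Qed.

(** The bumps at scale [a] live where those at scale [2 * a] are already 1. This makes the supports
    of the humps in [tight] disjoint. *)
Lemma cover_double a J x : 0 < a -> 0 < cover_fun a J x -> cover_fun (2 * a) J x = 1.
Proof.
move=> a0 /(cover_gt0 a0)[i iJ ix]; apply: cover_eq1 iJ ix.
by rewrite mulr_gt0.
Qed.

Lemma cover_cvg a x : 0 < a -> cover_fun a J x @[J --> \oo] --> (1 : R).
Proof.
move=> a0; have [i ix] := dc x a0.
apply/cvgrPdist_lt => e e0; exists i.+1 => // J /= iJ.
by rewrite (cover_eq1 a0 iJ (ltW ix)) subrr normr0.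
Qed.

Lemma mean_cover_cvg mu a : is_prob mu -> 0 < a ->
  mean mu (cover_fun a J) @[J --> \oo] --> (1 : R).
Proof.
move=> pm a0; rewrite -[X in _ --> X](mean_cst 1 pm).
apply: (@mean_dct _ _ mu _ _ 1 _ _ _).2.
- by move=> J; exact/lip01_bb/cover_lip01.
- by move=> J x; have /andP[? ?] := cover01 a J x; rewrite ger0_norm.
- by move=> x; exact: cover_cvg.
Qed.

End dense.
End polish_tools.

(** * Tightness *)

Section tightness.
Context {R : realType} {X : pmetricType R}.
Context {Pm : R -> fmeasure X R -> fmeasure X R} {Pf : R -> (X -> R) -> (X -> R)}.
Hypothesis MF : markov_feller Pm Pf.
Implicit Types (mu nu : fmeasure X R) (f g : X -> R) (A B : set X) (x y : X).
Local Notation d := (@mdist R X).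
Local Notation law n x := (@law R X Pm n%:R x).
Local Notation PP n := (Pf n%:R).
Variable z : X.
Hypotheses (ECz : eventually_continuous_at Pf z) (LBz : lower_bound_cond Pm z).

Lemma law1 n x : is_prob (law n x). Proof. exact: (law_prob MF _ (ler0n _ _)). Qed.

Lemma lower_bound_nat e : 0 < e -> exists2 b : R, 0 < b & forall x,
  \forall n \near \oo, b <= mean (law n x) (\1_(ball z e)).
Proof.
move=> e0; have [b b0 Hb] := lower_boundP LBz e0; exists b => // x.
exact: (cvgr_idn (Hb x)).
Qed.

Lemma mean_lawS m n x f : bounded_borel f ->
  mean (law (m + n) x) f = mean (law m x) (PP n f).
Proof.
by move=> bf; rewrite natrD !(mean_law MF) ?(Pf_add MF)//; exact: (Pf_bb MF).
Qed.

(** The joint support of the laws from [z] at integer times, on which Baire's theorem is applied. *)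
Definition reachable x := forall e, 0 < e -> exists m, 0 < mean (law m z) (\1_(ball x e)).

Lemma reachable_self : reachable z.
Proof.
move=> e e0; have [b b0 Hb] := lower_bound_nat e0.
by have [n Hn] := filter_ex (Hb z); exists n; exact: lt_le_trans Hn.
Qed.

Lemma reachable_closed : closed reachable.
Proof.
move=> x cx e e0.
have e20 : 0 < e / 2 by lra.
have [y [Ry]] := cx (ball x (e / 2)) (nbhsx_ballx _ _ e20).
rewrite ballEmdist /= => xy; have [m Hm] := Ry _ e20.
exists m; apply: (lt_le_trans Hm); apply: le_mean.
- by apply: bb_indic; exact: ball_borel.
- by apply: bb_indic; exact: ball_borel.
- move=> w; rewrite !indicE; have [wB|_] := boolP (w \in (ball y (e / 2) : set X)); last by case: (w \in _); rewrite /= ?ler01 ?lexx.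
  suff -> : w \in (ball x e : set X) by rewrite lexx.
  move: wB; rewrite !inE !ballEmdist /= => yw.
  have := metric_triangle x y w; lra.
Qed.

(** Off this set every point has a ball that no law charges, so [null_local] applies. *)
Lemma reachable_full (c : nat -> X) m : dense_seq c -> (law m z).-negligible (~` reachable).
Proof.
move=> dc; apply: (null_local dc) => x /existsNP[e /not_implyP[e0 /forallNP H]].
exists e => //; rewrite measure_mean; last exact: ball_borel.
have mB := bb_indic (ball_borel x e).
congr EFin; apply/eqP; rewrite eq_le; apply/andP; split.
  by rewrite leNgt; apply/negP; exact: H.
rewrite -(@mean_cst _ _ (law m z) 0 (law1 m z)); by apply: le_mean => //; exact: bb_cst.
Qed.

(** Some time [m] charges the ball from [z], hence also from a neighbourhood of [z]. The chain
    returns to that neighbourhood with mass at least [b] at every late time, and [m] further steps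
    lead to the ball. *)
Lemma reachable_charged x e : reachable x -> 0 < e ->
  exists2 b, 0 < b & \forall n \near \oo, b <= mean (law n z) (\1_(ball x e)).
Proof.
move=> Rx e0; have [m Hm] := Rx e e0.
have bB := bb_indic (ball_borel x e).
have b01 y : 0 <= (\1_(ball x e) y : R) <= 1.
  by rewrite indicE; case: (y \in _); rewrite /= ?lexx ?ler01.
have [h [lh hB hcv]] := lsc_approx b01 (open_lsc (open_mball x e)).
have hb n : bounded_borel (h n) by exact: lip01_bb.
have [_ hcvg] : bounded_borel (\1_(ball x e) : X -> R) /\
    mean (law m z) (h n) @[n --> \oo] --> mean (law m z) (\1_(ball x e)).
  apply: (@mean_dct _ _ _ _ _ 1) => // n y.
  by have [H _] := lh n; have /andP[? ?] := H y; rewrite ger0_norm.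
have [k _ /(_ k (leqnn _)) hk] := cvgr_gt _ hcvg _ Hm.
set q := mean _ _ in hk.
have qE : q = PP m (h k) z by rewrite /q (mean_law MF).
have bP : bounded_borel (PP m (h k)) by exact: (Pf_bb MF).
(* Feller property: [PP m (h k)] is continuous and equals [q > 0] at [z]. The Lipschitz minorant
   [h k] replaces the indicator for this purpose. *)
have [r r0 Hr] : exists2 r : R, 0 < r & forall y, d z y < r -> q / 2 < PP m (h k) y.
  apply: (cts_lsc (Pf_cts MF (ler0n _ _) (lip01_bc (lh k)))).
  by rewrite -qE; lra.
have [b b0 Hb] := lower_bound_nat r0.
exists (q / 2 * b); first by rewrite mulr_gt0//; lra.
have [N _ HN] := Hb z; exists (N + m)%N => // n /= Nn.
have mn : (m <= n)%N by apply: leq_trans Nn; exact: leq_addl.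
rewrite -(subnK mn) mean_lawS//.
have HNm := HN (n - m)%N (ltac:(rewrite /= leq_subRL// addnC//)).
apply: (@le_trans _ _ (q / 2 * mean (law (n - m) z) (\1_(ball z r)))).
  by rewrite ler_pM2l//; lra.
have bz := bb_indic (ball_borel z r).
rewrite -meanZ//; apply: le_mean; [exact: bbZ|exact: (Pf_bb MF)|] => y.
apply: (@le_trans _ _ (PP m (h k) y)); last first.
  by rewrite -!(mean_law MF)//; apply: le_mean.
have f01 : forall x, 0 <= h k x <= 1 by case: (lh k).
have /andP[p0 _] := Pf01 MF (ler0n _ m) (hb k) f01 y.
rewrite indicE; have [yz|] := boolP (y \in (ball z r : set X)); last by rewrite mulr0.
rewrite mulr1 ltW// Hr//.
by move: yz; rewrite inE ballEmdist.
Qed.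

(** * Gliding hump along disjointly supported Lipschitz functions *)

Section hump.
Variables (f psi : nat -> X -> R) (n_ : nat -> nat) (K eps : R).
Hypotheses (eps0 : 0 < eps) (K0 : 0 <= K).
Hypothesis f01 : forall i x, 0 <= f i x <= 1.
Hypothesis fK : forall i x y, `|f i x - f i y| <= K * d x y.
Hypothesis f_disj : forall i j x, (i < j)%N -> f i x = 0 \/ f j x = 0.
Hypothesis n_ge : forall i, (i <= n_ i)%N.
Hypothesis psi_bb : forall i, bounded_borel (psi i).
Hypothesis psi01 : forall i x, 0 <= psi i x <= 1.
Hypothesis psi_cvg : forall x, psi i x @[i --> \oo] --> (0 : R).
Hypothesis f_psi : forall i j x, (i <= j)%N -> f j x <= psi i x.
Hypothesis f_mass : forall i, eps <= mean (law (n_ i) z) (f i).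

Let f_lip i : lip01 (f i). Proof. by split => //; exists K. Qed.

(* Gliding hump: otherwise a sparse supremum of the f_i contradicts the merging of P_n f x and P_n f z. *)
Lemma hump x : \forall i \near \oo, eps / 2 <= PP (n_ i) (f i) x.
Proof.
apply: contrapT => Hx.
have bad N : exists i, (N <= i)%N /\ PP (n_ i) (f i) x < eps / 2.
  apply: contrapT => /forallNP H; apply: Hx; exists N => // i /= Ni.
  by rewrite leNgt; apply/negP => lt; apply: (H i).
(* The supremum over a finite list of selected indices; [h] below is the supremum over all of
   them. *)
pose gs (s : seq nat) y := \big[Num.max/0]_(i <- s) f i y.
have gs_cons i s y : gs (i :: s) y = Num.max (f i y) (gs s y) by rewrite /gs big_cons.
have gs01 s y : 0 <= gs s y <= 1.
  elim: s => [|i s IH]; first by rewrite /gs big_nil lexx ler01.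
  rewrite gs_cons; have /andP[a1 a2] := f01 i y; have /andP[b1 b2] := IH.
  by rewrite le_max a1 /= ge_max a2.
have gsK s y y' : `|gs s y - gs s y'| <= K * d y y'.
  elim: s => [|i s IH]; first by rewrite /gs !big_nil subrr normr0 mulr_ge0 ?mdist_ge0.
  by rewrite !gs_cons (le_trans (ler_norm_max _ _ _ _))// ge_max fK.
have gs_le s y b : 0 <= b -> (forall i, i \in s -> f i y <= b) -> gs s y <= b.
  move=> b0; elim: s => [|i s IH] H; first by rewrite /gs big_nil.
  rewrite gs_cons ge_max H ?mem_head//= IH// => j js.
  by rewrite H// inE js orbT.
have le_gs s y i : i \in s -> f i y <= gs s y.
  elim: s => [//|j s IH]; rewrite inE gs_cons le_max => /predU1P[->|/IH ->].
    by rewrite lexx.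
  by rewrite orbT.
have gs_lip s : lip01 (gs s) by split => //; exists K.
have gs_bb s := lip01_bb (gs_lip s).
have fbb i := lip01_bb (f_lip i).
have tail m : \forall j \near \oo, mean (law m x) (psi j) < eps / 8.
  have [_ H] : bounded_borel (fun _ : X => 0 : R) /\
      mean (law m x) (psi j) @[j --> \oo] --> mean (law m x) (fun=> 0).
    apply: (@mean_dct _ _ _ _ _ 1) => // j y.
    by have /andP[? ?] := psi01 j y; rewrite ger0_norm.
  by rewrite (mean_cst _ (law1 m x)) in H; exact: (cvgr_lt _ H _ (divr_gt0 eps0 (ltr0n R 8))).
have past s : \forall j \near \oo, PP j (gs s) z - PP j (gs s) x >= - (eps / 8).
  have [N _ HN] := osc0 MF ECz LBz (gs_lip s) (cvgr_idn (R := R)) x z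
    (divr_gt0 eps0 (ltr0n R 8)).
  by exists N => // j /HN /=; lra.
(* The next index is bad at [x], late enough that the selected past has nearly merged at time
   [n_ i], and far enough that everything beyond it is negligible for the law at the previous
   time. *)
have next s : exists i, [/\ (head 0%N s < i)%N, mean (law (n_ (head 0%N s)) x) (psi i) < eps / 8,
   PP (n_ i) (gs s) z - PP (n_ i) (gs s) x >= - (eps / 8) & PP (n_ i) (f i) x < eps / 2].
  have [N1 _ H1] := tail (n_ (head 0%N s)); have [N2 _ H2] := past s.
  have [i [Ni Hi]] := bad (maxn (head 0%N s).+1 (maxn N1 N2)).
  move: Ni; rewrite !geq_max => /and3P[i0 i1 i2].
  exists i; split => //; first exact: H1.
  by apply: H2 => /=; exact: leq_trans (n_ge i).
have [nx nxP] := choice next.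
(* Selected indices, latest first. The initial index 0 need not be bad, since only indices
   [idx k.+1] are tested. *)
pose S := fix S k := if k is k'.+1 then nx (S k') :: S k' else [:: 0%N].
pose idx k := head 0%N (S k).
have idxS k : idx k.+1 = nx (S k) by [].
have idx_lt k : (idx k < idx k.+1)%N by have [] := nxP (S k).
have idx_mono k l : (k <= l)%N -> (idx k <= idx l)%N.
  move=> /subnKC <-; elim: (l - k)%N => [|m IH]; first by rewrite addn0.
  by rewrite addnS (leq_trans IH)// ltnW.
have mem_idx k i : i \in S k -> exists2 l, (l <= k)%N & i = idx l.
  elim: k => [|k IH] /=; first by rewrite inE => /eqP ->; exists 0%N.
  rewrite inE => /predU1P[->|/IH[l lk ->]]; first by exists k.+1.
  by exists l => //; exact: leqW.
have idx_in k l : (l <= k)%N -> idx l \in S k.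
  elim: k => [|k IH]; first by rewrite leqn0 => /eqP ->; rewrite inE.
  by rewrite leq_eqVlt => /predU1P[->|/IH]; rewrite /= inE ?eqxx// => ->; rewrite orbT.
pose E y := [set f (idx k) y | k in [set: nat]].
have E0 y : E y !=set0 by exists (f (idx 0%N) y), 0%N.
have ubE y : ubound (E y) 1 by move=> _ [k _ <-]; case/andP: (f01 (idx k) y).
pose h y := sup (E y).
have hle y k : f (idx k) y <= h y by apply: ub_le_sup; [exists 1|exists k].
have leh y b : (forall k, f (idx k) y <= b) -> h y <= b.
  by move=> H; apply: ge_sup => // _ [k _ <-].
have h_lip : lip01 h.
  split.
    move=> y; apply/andP; split; last by apply: leh => k; case/andP: (f01 (idx k) y).
    by apply: le_trans (hle y 0%N); case/andP: (f01 (idx 0%N) y).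
  exists K => y y'.
  have H u v : h u <= h v + K * d u v.
    apply: leh => k; have := fK (idx k) u v; have := hle v k.
    by rewrite ler_norml; lra.
  have := H y y'; have := H y' y; rewrite (metric_sym y' y) ler_norml; lra.
have [N _ HN] := osc0 MF ECz LBz h_lip (cvgr_idn (R := R)) z x (divr_gt0 eps0 (ltr0n R 8)).
have idx_ge k : (k <= idx k)%N by elim: k => // k /leq_ltn_trans; apply.
pose i := idx N.+1.
have Ni : (N <= n_ i)%N.
  by apply: leq_trans (n_ge i); apply: leq_trans (idx_ge N.+1).
have Hosc : PP (n_ i) h z - PP (n_ i) h x <= 0 + eps / 8 := HN (n_ i) Ni.
have [Hpast Hf] : - (eps / 8) <= PP (n_ i) (gs (S N)) z - PP (n_ i) (gs (S N)) x /\
    PP (n_ i) (f i) x < eps / 2 by have [_ _ H1 H2] := nxP (S N).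
have Htail : mean (law (n_ i) x) (psi (idx N.+2)) < eps / 8.
  by have [_ H _ _] := nxP (S N.+1).
have bh := lip01_bb h_lip.
(* Disjointness of supports turns the maximum of past and present into a sum, so the present hump
   adds a full [eps] at [z]. *)
have Hz : PP (n_ i) (gs (S N)) z + eps <= PP (n_ i) h z.
  rewrite -!(mean_law MF)//; apply: le_trans (lerD (lexx _) (f_mass i)) _.
  rewrite -meanD//; apply: le_mean => //; first exact: bbD.
  move=> y; have h0 : 0 <= h y by case: h_lip => /(_ y)/andP[].
  have hg : gs (S N) y <= h y.
    by apply: gs_le => // j /mem_idx[l _ ->]; exact: hle.
  have hf : f i y <= h y := hle y N.+1.
  have [fi0|fi0] := eqVneq (f i y) 0; first by rewrite fi0 addr0.
  suff -> : gs (S N) y = 0 by rewrite add0r.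
  apply/eqP; rewrite eq_le; have /andP[-> _] := gs01 (S N) y; rewrite andbT.
  apply: gs_le => // j /mem_idx[l lN ->].
  have [->//|/eqP] := f_disj y (leq_ltn_trans (idx_mono _ _ lN) (idx_lt N)).
  by rewrite -/i (negbTE fi0).
(* At [x] the past, the present and the future are bounded separately, the future by [psi]. *)
have Hx' : PP (n_ i) h x <= PP (n_ i) (gs (S N)) x + PP (n_ i) (f i) x
    + mean (law (n_ i) x) (psi (idx N.+2)).
  rewrite -!(mean_law MF)// -!meanD//; last exact: bbD.
  apply: le_mean => //; first by apply: bbD => //; exact: bbD.
  move=> y; apply: leh => k.
  have /andP[g0 _] := gs01 (S N) y; have /andP[p0 _] := psi01 (idx N.+2) y.
  have /andP[f0 _] := f01 i y.
  have [kN|] := leqP k N; first by have := le_gs (S N) y _ (idx_in _ _ kN); lra.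
  rewrite leq_eqVlt => /predU1P[<-|Nk]; first by rewrite -/i; lra.
  by have := f_psi y (idx_mono _ _ Nk); lra.
(* The errors total less than [3 * (eps / 8) + eps / 2], which is below the gap [eps]. *)
move: Hosc Hpast Hf Htail Hz Hx'; move: (PP (n_ i) h z) (PP (n_ i) h x)
  (PP (n_ i) (gs (S N)) z) (PP (n_ i) (gs (S N)) x) (PP (n_ i) (f i) x)
  (mean (law (n_ i) x) (psi (idx N.+2))) => a1 a2 a3 a4 a5 a6 *.
move: eps0; lra.
Qed.

End hump.
End tightness.

(** * Tightness of the integer-time laws started at [z] *)

Section tight.
Context {R : realType} {X : pmetricType R}.
Context {Pm : R -> fmeasure X R -> fmeasure X R} {Pf : R -> (X -> R) -> (X -> R)}.
Hypothesis MF : markov_feller Pm Pf.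
Implicit Types (mu nu : fmeasure X R) (f g : X -> R) (A B : set X) (x y : X).
Local Notation d := (@mdist R X).
Local Notation law n x := (@law R X Pm n%:R x).
Local Notation PP n := (Pf n%:R).
Variable z : X.
Hypotheses (ECz : eventually_continuous_at Pf z) (LBz : lower_bound_cond Pm z).
Variable c : nat -> X.
Hypotheses (cX : complete_metric (X := X)) (dc : dense_seq c).

(** At each point at most one summand is nonzero. *)
Lemma disjoint_sum_le1 (f : nat -> X -> R) N k x : (forall i x, 0 <= f i x <= 1) ->
  (forall i j x, (i < j)%N -> f i x = 0 \/ f j x = 0) ->
  \sum_(i < k) f (N + i)%N x <= 1.
Proof.
move=> f01 fd; elim: k => [|k IH]; first by rewrite big_ord0.
rewrite big_ord_recr /=; have [->|/eqP fk] := eqVneq (f (N + k)%N x) 0.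
  by rewrite addr0.
rewrite big1 ?add0r; first by case/andP: (f01 (N + k)%N x).
by move=> i _; have [] := fd (N + i)%N (N + k)%N x; rewrite ?ltn_add2l.
Qed.

(** The sets [O N] of points violating the bound at some index from [N] on are open by the Feller
    property. Were they all relatively dense in the reachable set, Baire would give a point
    violating it infinitely often. *)
Lemma uniform_on_ball (f : nat -> X -> R) (n_ : nat -> nat) (e : R) :
  (forall i, lip01 (f i)) ->
  (forall x, \forall i \near \oo, e <= PP (n_ i) (f i) x) ->
  exists N x0 r, [/\ reachable (Pm := Pm) z x0, 0 < r &
    forall y, reachable (Pm := Pm) z y -> ball x0 r y ->
      forall i, (N <= i)%N -> e <= PP (n_ i) (f i) y].
Proof.
move=> fl He; apply: contrapT => H.
pose O N := \bigcup_(i in [set i | (N <= i)%N]) [set x | PP (n_ i) (f i) x < e].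
have [||||y [_ Hy]] := @baire_rel R X (reachable (Pm := Pm) z) O cX.
- exact: reachable_closed.
- by exists z; exact: reachable_self LBz.
- move=> N; apply: bigcup_open => i _.
  have cP : continuous (PP (n_ i) (f i)).
    by apply: (Pf_cts MF (ler0n _ _)); exact: lip01_bc.
  have -> : [set x | PP (n_ i) (f i) x < e] = PP (n_ i) (f i) @^-1` [set u | u < e] by [].
  by apply: open_comp; [move=> y _; exact: cP|exact: open_lt].
- move=> N x r Rx r0; apply: contrapT => /forallNP Hy; apply: H.
  exists N, x, r; split => // y Ry xy i Ni; rewrite leNgt; apply/negP => lt.
  by apply: (Hy y); split => //; exists i.
- have [N _ HN] := He y; have [i /= Ni] := Hy N.
  by move=> lt; have := HN i Ni; rewrite leNgt lt.
Qed.

Lemma tight eps a : 0 < eps -> 0 < a ->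
  exists J, forall n, 1 - eps <= mean (law n z) (cover_fun c a J).
Proof.
move=> eps0 a0; apply: contrapT => /forallNP Hbad.
(* Humps are built at scale [b] and cut off at scale [a = 2 * b], as [cover_double] requires. *)
pose b := a / 2; have b0 : 0 < b by rewrite /b; lra.
have ab : a = 2 * b by rewrite /b; lra.
have cvb a' J : 0 < a' -> bounded_borel (cover_fun c a' J).
  by move=> a'0; exact/lip01_bb/cover_lip01.
have cover_big a' e n : 0 < a' -> 0 < e ->
    \forall J \near \oo, 1 - e < mean (law n z) (cover_fun c a' J).
  move=> a'0 e0; apply: (cvgr_gt _ (mean_cover_cvg dc (law1 MF n z) a'0)).
  lra.
(* The finitely many laws before [N] are handled by enlarging [J], so a failure must occur at or
   after [N]. *)
have bad J N : exists2 n, (N <= n)%N & mean (law n z) (cover_fun c a J) < 1 - eps.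
  have [J' JJ' HJ'] : exists2 J', (J <= J')%N &
      forall n, (n < N)%N -> 1 - eps <= mean (law n z) (cover_fun c a J').
    elim: N => [|N [J1 JJ1 HJ1]]; first by exists J.
    have [J2 _ HJ2] := cover_big a eps N a0 eps0.
    exists (maxn J1 J2); first by rewrite leq_max JJ1.
    move=> n; rewrite ltnS leq_eqVlt => /predU1P[->|/HJ1 H].
      by apply: ltW; apply: HJ2; exact: leq_maxr.
    apply: (le_trans H); apply: le_mean; try exact: cvb.
    by move=> x; apply: cover_mono; exact: leq_maxl.
  have /existsNP[n /negP] := Hbad J'; rewrite -ltNge => Hn.
  exists n.
    by rewrite leqNgt; apply/negP => /HJ'; rewrite leNgt Hn.
  apply: le_lt_trans Hn; apply: le_mean; try exact: cvb.
  by move=> x; exact: cover_mono.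
(* A pair is a cover size and a time. The next size captures the current law up to [eps / 2] at
   scale [b]; the next time is one at which that size fails at scale [a]. *)
have step (p : nat * nat) : exists q : nat * nat, [/\ (p.1 < q.1)%N, (q.1 <= q.2)%N,
    1 - eps / 2 < mean (law p.2 z) (cover_fun c b q.1) &
    mean (law q.2 z) (cover_fun c a q.1) < 1 - eps].
  have [J _ HJ] := cover_big b (eps / 2) p.2 b0 ltac:(lra).
  have [n Jn Hn] := bad (maxn J p.1.+1) (maxn J p.1.+1).
  exists (maxn J p.1.+1, n); split => //=; first exact: leq_maxr.
  by apply: HJ; exact: leq_maxl.
have [nxt Hq] := choice step.
have [n0 _ Hn0] := bad 0%N 0%N.
pose s := fix s i := if i is i'.+1 then nxt (s i') else (0%N, n0).
pose J i := (s i).1; pose n_ i := (s i).2.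
have JS i : (J i < J i.+1)%N by have [] := Hq (s i).
have Jn i : (J i <= n_ i)%N by case: i => [//|i]; have [] := Hq (s i).
have big i : 1 - eps / 2 < mean (law (n_ i) z) (cover_fun c b (J i.+1)).
  by have [] := Hq (s i).
have small i : mean (law (n_ i) z) (cover_fun c a (J i)) < 1 - eps.
  by case: i => [|i]; [exact: Hn0|have [] := Hq (s i)].
have Ji i : (i <= J i)%N by elim: i => // i /leq_ltn_trans; apply.
have Jmono i j : (i <= j)%N -> (J i <= J j)%N.
  move=> /subnKC <-; elim: (j - i)%N => [|m IH]; first by rewrite addn0.
  by rewrite addnS (leq_trans IH)// ltnW.
(* This is the minimum of the new cover at scale [b] and the complement of the old cover at scale
   [a]: a shell of the exhaustion. *)
pose f i x := 1 - Num.max (1 - cover_fun c b (J i.+1) x) (cover_fun c a (J i) x).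
pose psi i x := 1 - cover_fun c a (J i) x.
have f01 i x : 0 <= f i x <= 1.
  have /andP[? ?] := cover01 c b (J i.+1) x; have /andP[? ?] := cover01 c a (J i) x.
  by rewrite /f; case: (leP (1 - _) (cover_fun _ _ _ _)) => ?; lra.
have fK i x y : `|f i x - f i y| <= b^-1 * d x y.
  rewrite /f opprB addrC addrA subrK distrC (le_trans (ler_norm_max _ _ _ _))// ge_max.
  apply/andP; split.
    rewrite (_ : _ - _ = cover_fun c b (J i.+1) y - cover_fun c b (J i.+1) x); last by ring.
    by rewrite distrC; exact: cover_lip.
  apply: (le_trans (cover_lip _ _ _ _ a0)); apply: ler_wpM2r; first exact: mdist_ge0.
  by rewrite lef_pV2 ?posrE//; lra.
have fd i j x : (i < j)%N -> f i x = 0 \/ f j x = 0.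
  move=> ij; have [fi0|fi0] := eqVneq (f i x) 0; [by left|right].
  have c1 : cover_fun c b (J i.+1) x <= 1 by case/andP: (cover01 c b (J i.+1) x).
  have pos : 0 < cover_fun c b (J i.+1) x.
    rewrite lt_neqAle; have /andP[-> _] := cover01 c b (J i.+1) x; rewrite andbT.
    apply/eqP => e0; move/eqP: fi0; apply; rewrite /f -e0 subr0.
    by have /andP[_ ?] := cover01 c a (J i) x; rewrite max_l// subrr.
  have e1 : cover_fun c a (J j) x = 1.
    apply/eqP; rewrite eq_le; have /andP[_ ->] := cover01 c a (J j) x => /=.
    have := cover_double (c := c) b0 pos; rewrite -ab => <-.
    by apply: cover_mono; exact: Jmono.
  rewrite /f e1 max_r ?subrr//; have /andP[? _] := cover01 c b (J j.+1) x; lra.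
have fpsi i j x : (i <= j)%N -> f j x <= psi i x.
  move=> ij; rewrite /f /psi lerD2l lerN2 le_max.
  by rewrite (cover_mono c a x (Jmono _ _ ij)) orbT.
have fl i : lip01 (f i) by split => //; exists b^-1.
have fbb i := lip01_bb (fl i).
(* The shell dominates new cover minus old cover, whose mean exceeds [(1 - eps / 2) - (1 - eps)]. *)
have mass i : eps / 2 <= mean (law (n_ i) z) (f i).
  have : mean (law (n_ i) z) (fun x => cover_fun c b (J i.+1) x - cover_fun c a (J i) x) <=
      mean (law (n_ i) z) (f i).
    apply: le_mean => //; first by apply: bbB; exact: cvb.
    move=> x; have /andP[? ?] := cover01 c b (J i.+1) x.
    have /andP[? ?] := cover01 c a (J i) x.
    by rewrite /f; case: (leP (1 - _) (cover_fun _ _ _ _)) => ?; lra.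
  rewrite meanB; [|exact: cvb|exact: cvb].
  have := big i; have := small i; lra.
have psi01 i x : 0 <= psi i x <= 1.
  by have /andP[? ?] := cover01 c a (J i) x; rewrite /psi; lra.
have psi_bb i : bounded_borel (psi i).
  by apply: bbB; [exact: bb_cst|exact: cvb].
have psi0 x : psi i x @[i --> \oo] --> (0 : R).
  rewrite -[X in _ --> X](subrr (1 : R)); apply: cvgB; first exact: cvg_cst.
  apply/cvgrPdist_lt => e e0.
  have [N _ HN] := (cvgrPdist_lt _ _).1 (cover_cvg dc x a0) e e0.
  by exists N => // i /= Ni; apply: HN => /=; exact: leq_trans (Ji i).
have ni i : (i <= n_ i)%N by exact: leq_trans (Jn i).
have bi0 : 0 <= b^-1 by rewrite invr_ge0 ltW.
have hu := hump MF ECz LBz (ltac:(lra) : 0 < eps / 2) bi0 f01 fK fd ni psi_bb psi01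
  psi0 fpsi mass.
have [N [x0 [r [Rx r0 Hr]]]] := uniform_on_ball fl hu.
have [be be0 [M0 _ HM0]] := reachable_charged MF LBz Rx r0.
have mBr := ball_borel x0 r; have bB := bb_indic mBr.
pose q := eps / 2 / 2 * be.
have q0 : 0 < q by rewrite /q mulr_gt0//; lra.
(* More than [q^-1] disjoint humps, each of mass at least [q] at one common time, exceed total mass
   1. *)
have [k Hk] : exists k : nat, q^-1 < k%:R.
  by have [k _ /(_ k (leqnn _))] := nbhs_infty_gtr q^-1; exists k.
(* The sum is a convenient time from which every [n_ (N + i)] can be subtracted leaving at least
   [M0]. *)
pose T := (M0 + \sum_(i < k) n_ (N + i))%N.
have lowT (i : 'I_k) : q <= mean (law T z) (f (N + i)%N).
  have nT : (M0 + n_ (N + i) <= T)%N.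
    by rewrite leq_add2l (bigD1 i)//= leq_addr.
  have nT' : (n_ (N + i) <= T)%N by apply: leq_trans nT; exact: leq_addl.
  rewrite -(subnK nT') (mean_lawS MF)//.
  set m := (T - _)%N.
  have Mm : (M0 <= m)%N by rewrite /m leq_subRL// addnC.
  have [Nu [mNu Nu0 subNu]] := reachable_full MF z m dc.
  have bNu := bb_indic mNu.
  have bP : bounded_borel (PP (n_ (N + i)) (f (N + i)%N)) by exact: (Pf_bb MF).
  (* The bound on [ball x0 r] is known only at reachable points; the indicator of the null set [Nu]
     absorbs the others. *)
  have : mean (law m z) (fun x => eps / 2 / 2 * \1_(ball x0 r) x) <=
    mean (law m z) (fun x => PP (n_ (N + i)) (f (N + i)%N) x + eps / 2 / 2 * \1_Nu x).
    apply: le_mean; [exact: bbZ|by apply: bbD => //; exact: bbZ|] => x.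
    have /andP[p0 _] := Pf01 MF (ler0n _ (n_ (N + i)%N)) (fbb (N + i)%N) (f01 (N + i)%N) x.
    have n0' : 0 <= eps / 2 / 2 * \1_Nu x by apply: mulr_ge0 => //; lra.
    rewrite [in leLHS]indicE; have [xB|_] := boolP (x \in (ball x0 r : set X)); last first.
      by rewrite mulr0 addr_ge0.
    rewrite mulr1; have [Rex|nRx] := pselect (reachable (Pm := Pm) z x).
      have := Hr x Rex (set_mem xB) (N + i)%N (leq_addr _ _); lra.
    rewrite indicE mem_set ?mulr1; last exact: subNu.
    lra.
  rewrite meanD//; last exact: bbZ.
  rewrite !meanZ// (mean_indic _ mNu) Nu0 mulr0 addr0; apply: le_trans.
  rewrite /q ler_pM2l; last by lra.
  exact: HM0.
have : \sum_(i < k) mean (law T z) (f (N + i)%N) <= 1.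
  rewrite -(mean_sum (law T z) (index_enum 'I_k) (F := fun (i : 'I_k) => f (N + i)%N))//.
  rewrite -[X in _ <= X](mean_cst 1 (law1 MF T z)); apply: le_mean.
  - exact: bb_sum.
  - exact: bb_cst.
  - by move=> x; exact: disjoint_sum_le1.
have : \sum_(i < k) q <= \sum_(i < k) mean (law T z) (f (N + i)%N).
  by apply: ler_sum => i _; exact: lowT.
rewrite sumr_const card_ord -[q *+ k]mulr_natl => H1 H2.
have : 1 < k%:R * q by rewrite -ltr_pdivrMr// div1r.
by rewrite ltNge (le_trans H1 H2).
Qed.

End tight.

(** * Ultrafilter limits of tight sequences *)

Section limit_measure.
Context {R : realType} {X : pmetricType R}.
Implicit Types (mu nu : fmeasure X R) (f g : X -> R) (A B : set X) (x y : X)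
  (w : seq nat).
Local Notation d := (@mdist R X).

Lemma ultra_fmap (S T : Type) (U : set_system S) (u : S -> T) :
  UltraFilter U -> UltraFilter (u @ U).
Proof.
move=> UU; split; first exact: fmap_proper_filter.
move=> G GP UG; apply/seteqP; split => // B GB.
have [//|UnB] := in_ultra_setVsetC (u @^-1` B) UU.
have nB : G (~` B) by exact: UG.
have G0 : G set0 by rewrite -(setICr B); apply: filterI.
by case: (@filter_not_empty _ G _ G0).
Qed.

Lemma ultra_cvg01 (U : set_system nat) (u : nat -> R) : UltraFilter U ->
  (forall n, 0 <= u n <= 1) -> exists l : R, u n @[n --> U] --> l.
Proof.
move=> UU u01; have := @segment_compact R 0 1; rewrite compact_ultra => H.
have HU : (u @ U) `[0, 1]%classic.
  rewrite nbhs_filterE /fmap /=.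
  have -> : u @^-1` `[0, 1] = setT.
    by apply/seteqP; split => // n _; rewrite /= in_itv /= u01.
  exact: filterT.
by have [l [_ ul]] := H (u @ U) (ultra_fmap u UU) HU; exists l.
Qed.

(** Mutually exclusive conditions leave at most one term; this evaluates step functions over cells
    and over intervals. *)
Lemma sum_unique (I : eqType) (s : seq I) (P : I -> bool) (F : I -> R) : uniq s ->
  (forall i j, i \in s -> j \in s -> P i -> P j -> i = j) ->
  (\sum_(i <- s) (P i)%:R * F i = 0 /\ forall i, i \in s -> ~~ P i) \/
  exists i, [/\ i \in s, P i & \sum_(i <- s) (P i)%:R * F i = F i].
Proof.
move=> us Pu; have [/hasP[i si Pi]|/hasPn nP] := boolP (has P s).
  right; exists i; split => //; rewrite (bigD1_seq i)//= Pi mul1r.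
  rewrite big_seq_cond big1 ?addr0// => j /andP[sj ji].
  have [Pj|] := boolP (P j); last by rewrite mul0r.
  by rewrite (Pu _ _ sj si Pj Pi) eqxx in ji.
left; split; last by move=> i /nP.
by rewrite big_seq big1// => i /nP /negbTE ->; rewrite mul0r.
Qed.

Section limit.
Variables (c : nat -> X) (m : nat -> fmeasure X R).
Hypothesis pm : forall n, is_prob (m n).
Hypothesis tm : forall eps a, 0 < eps -> 0 < a ->
  exists J, forall n, 1 - eps <= mean (m n) (cover_fun c a J).
Variable U : set_system nat.
Hypothesis UU : UltraFilter U.

Let rr k : R := (2 ^+ k)^-1.

Lemma rr_gt0 k : 0 < rr k. Proof. by rewrite invr_gt0 exprn_gt0. Qed.

Lemma rr_le k l : (k <= l)%N -> rr l <= rr k.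
Proof. by move=> kl; rewrite lef_pV2 ?posrE ?exprn_gt0// ler_eXn2l// ltr1n. Qed.

Lemma rr_small e : 0 < e -> exists k, rr k < e.
Proof.
move=> e0; have [N _ /(_ N (leqnn _)) HN] := near_infty_natSinv_lt (PosNum e0).
exists N; apply: le_lt_trans HN; rewrite lef_pV2 ?posrE ?exprn_gt0//.
by rewrite -natrX ler_nat ltn_expl.
Qed.

(** The balls at scale [k] made disjoint: the points whose first ball in the enumeration is the
    [i]-th. *)
Definition first_ball k i : set X :=
  ball (c i) (rr k) `\` \bigcup_(l < i) ball (c l) (rr k).

(* A word lists ball indices, the finest scale first. *)
Fixpoint cell w : set X :=
  if w is i :: w' then cell w' `&` first_ball (size w') i else setT.

Lemma first_ball_unique k i j x : first_ball k i x -> first_ball k j x -> i = j.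
Proof.
move=> [xi nxi] [xj nxj]; case: (ltngtP i j) => // lt.
  by case: nxj; exists i; [exact: lt|exact: xi].
by case: nxi; exists j; [exact: lt|exact: xj].
Qed.

Lemma first_ball_exists k x J i : (i < J)%N -> ball (c i) (rr k) x ->
  exists2 j, (j < J)%N & first_ball k j x.
Proof.
move=> iJ xi.
pose P l := `[< ball (c l) (rr k) x >].
have [j /asboolW xj jmin] := ex_minnP (ex_intro P i (asboolT xi)).
exists j; first by rewrite (leq_ltn_trans _ iJ)// jmin//; exact: asboolT.
split => // -[l /= lj xl]; have := jmin l (asboolT xl); by rewrite leqNgt lj.
Qed.

Lemma cell_unique w w' x : size w = size w' -> cell w x -> cell w' x -> w = w'.
Proof.
elim: w w' => [|i w IH] [|j w']//= [sw] [wx ix] [w'x jx].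
rewrite (IH w') //; congr cons; apply: first_ball_unique ix _.
by rewrite sw.
Qed.

Lemma cell_borel w : measurable (cell w : set (borel X)).
Proof.
elim: w => [|i w IH] /=; first exact: measurableT.
apply: measurableI => //; apply: measurableD; first exact: ball_borel.
by apply: bigcup_measurable => l _; exact: ball_borel.
Qed.

Let cellbb w : bounded_borel (\1_(cell w) : X -> R).
Proof. by apply: bb_indic; exact: cell_borel. Qed.

Lemma ulim_le (u v : nat -> R) a b : u n @[n --> U] --> a -> v n @[n --> U] --> b ->
  (forall n, u n <= v n) -> a <= b.
Proof. by move=> ua vb uv; apply: (ler_cvg_to ua vb); exact: nearW. Qed.

Lemma mean01 n g : bounded_borel g -> (forall x, 0 <= g x <= 1) ->
  0 <= mean (m n) g <= 1.
Proof.
move=> bg g01; rewrite -{1}(@mean_cst _ _ (m n) 0 (pm n)).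
rewrite -(@mean_cst _ _ (m n) 1 (pm n)).
by rewrite !le_mean//; try exact: bb_cst; move=> y; case/andP: (g01 y).
Qed.

Lemma indic01 A x : 0 <= (\1_A x : R) <= 1.
Proof. by rewrite indicE; case: (x \in A); rewrite /= ?lexx ?ler01. Qed.

Definition mass w : R := lim (mean (m n) (\1_(cell w)) @[n --> U]).

Lemma mass_cvg w : mean (m n) (\1_(cell w)) @[n --> U] --> mass w.
Proof.
have [l Hl] := ultra_cvg01 UU (fun n => mean01 n (cellbb w) (indic01 (cell w))).
by apply/cvg_ex; exists l.
Qed.

Lemma mass_ge0 w : 0 <= mass w.
Proof.
have H : (0 : R) @[n --> U] --> (0 : R) by exact: cvg_cst.
apply: (@ulim_le _ _ _ _ H (@mass_cvg w)) => n.
by have /andP[] := mean01 n (cellbb w) (indic01 (cell w)).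
Qed.

Lemma mass_nil : mass [::] = 1.
Proof.
apply: cvg_lim => //.
suff -> : (fun n => mean (m n) (\1_(cell [::]))) = fun=> 1 by exact: cvg_cst.
by apply/funext => n; rewrite /= mean_indic//= (pm n : m n _ = _).
Qed.

Lemma mass_gt0 w : 0 < mass w -> cell w !=set0.
Proof.
move=> p0; apply: contrapT => /set0P/negP; rewrite negbK => /eqP c0.
suff : mass w = 0 by move=> e; rewrite e ltxx in p0.
apply: cvg_lim => //.
suff -> : (fun n => mean (m n) (\1_(cell w))) = fun=> 0 by exact: cvg_cst.
apply/funext => n; rewrite mean_indic; last exact: cell_borel.
by rewrite c0 measure0.
Qed.

Lemma cvg_sum_mean (I : Type) (s : seq I) (F : I -> seq nat) (a : I -> R) :
  \sum_(i <- s) a i * mean (m n) (\1_(cell (F i))) @[n --> U] --> \sum_(i <- s) a i * mass (F i).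
Proof.
elim: s => [|i s IH].
  by rewrite big_nil; under eq_fun do rewrite big_nil; exact: cvg_cst.
rewrite big_cons; under eq_fun do rewrite big_cons.
apply: cvgD => //; apply: cvgM; [exact: cvg_cst|exact: mass_cvg].
Qed.

Lemma cell_sum_le w J x : \sum_(i < J) (\1_(cell ((i : nat) :: w)) x : R) <= \1_(cell w) x.
Proof.
pose P i := x \in cell ((i : nat) :: w).
have E : \sum_(i < J) (\1_(cell ((i : nat) :: w)) x : R) =
    \sum_(i <- iota 0 J) (P i)%:R * 1.
  rewrite -(big_mkord xpredT (fun i => \1_(cell ((i : nat) :: w)) x : R)) /index_iota subn0.
  by apply: eq_bigr => i _; rewrite indicE mulr1.
have [|i j _ _|[E0 _]|[i [_ Pi E1]]] := sum_unique (s := iota 0 J) (P := P) (fun=> 1).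
- exact: iota_uniq.
- by rewrite /P !inE => -[_ xi] [_ xj]; exact: first_ball_unique xi xj.
- by rewrite E E0; case/andP: (indic01 (cell w) x).
- rewrite E E1 indicE mem_set//.
  by move: Pi; rewrite /P inE => -[].
Qed.

(** A point of the cell in none of the first [J] subcells is outside the first [J] balls, so the
    cover function vanishes there. The factor 4 leaves room: a cover function at scale [a] lives
    within [2 * a], here half the radius of the balls. *)
Lemma cell_sum_ge w J x :
  \1_(cell w) x <= \sum_(i < J) (\1_(cell ((i : nat) :: w)) x : R) +
    (1 - cover_fun c (rr (size w) / 4) J x).
Proof.
have r0 := rr_gt0 (size w); have r40 : 0 < rr (size w) / 4 by lra.
have /andP[c0 c1] := cover01 c (rr (size w) / 4) J x.
have s0 : 0 <= \sum_(i < J) (\1_(cell ((i : nat) :: w)) x : R).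
  by apply: sumr_ge0 => i _; case/andP: (indic01 (cell ((i : nat) :: w)) x).
rewrite indicE; have [xw|_] := boolP (x \in cell w); last by rewrite /=; lra.
have [e0|ne0] := eqVneq (cover_fun c (rr (size w) / 4) J x) 0.
  by rewrite e0 /=; lra.
have [i iJ ix] : exists2 i, (i < J)%N & d (c i) x <= 2 * (rr (size w) / 4).
  by apply: cover_gt0 => //; rewrite lt_neqAle eq_sym ne0.
have [j jJ jx] : exists2 j, (j < J)%N & first_ball (size w) j x.
  by apply: first_ball_exists iJ _; rewrite ballEmdist /=; lra.
rewrite (bigD1 (Ordinal jJ))//= [in leRHS]indicE mem_set; last by split => //; exact: set_mem.
have : 0 <= \sum_(i < J | i != Ordinal jJ) (\1_(cell ((i : nat) :: w)) x : R).
  by apply: sumr_ge0 => l _; case/andP: (indic01 (cell ((l : nat) :: w)) x).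
by rewrite /=; lra.
Qed.

Let bbsum w J : bounded_borel (fun x => \sum_(i < J) (\1_(cell ((i : nat) :: w)) x : R)).
Proof. by apply: bb_sum => i; exact: cellbb. Qed.

Let sum_mass_cvg w J : \sum_(i < J) mean (m n) (\1_(cell ((i : nat) :: w))) @[n --> U]
  --> \sum_(i < J) mass ((i : nat) :: w).
Proof.
have -> : (fun n => \sum_(i < J) mean (m n) (\1_(cell ((i : nat) :: w)))) =
    (fun n => \sum_(i < J) 1 * mean (m n) (\1_(cell ((i : nat) :: w)))).
  by apply/funext => n; apply: eq_bigr => i _; rewrite mul1r.
have -> : \sum_(i < J) mass ((i : nat) :: w) = \sum_(i < J) 1 * mass ((i : nat) :: w).
  by apply: eq_bigr => i _; rewrite mul1r.
exact: (@cvg_sum_mean _ (index_enum 'I_J) (fun i : 'I_J => (i : nat) :: w) (fun=> 1)).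
Qed.

Lemma sum_mass_le w J : \sum_(i < J) mass ((i : nat) :: w) <= mass w.
Proof.
apply: (@ulim_le _ _ _ _ (@sum_mass_cvg w J) (@mass_cvg w)) => n.
rewrite -(mean_sum (m n) (index_enum 'I_J) (fun i : 'I_J => cellbb ((i : nat) :: w))).
by apply: le_mean => //; [exact: bbsum|move=> x; exact: cell_sum_le].
Qed.

(** Countable additivity survives the ultrafilter limit thanks to tightness: the mass outside the
    first [J] subcells is small uniformly in [n]. *)
Lemma sum_mass_cvgn w : \sum_(i < J) mass ((i : nat) :: w) @[J --> \oo] --> mass w.
Proof.
apply/cvgrPdist_lt => e e0.
have r40 : 0 < rr (size w) / 4 by have := rr_gt0 (size w); lra.
have e20 : 0 < e / 2 by lra.
have [J0 HJ0] := tm e20 r40.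
exists J0 => // J /= J0J.
rewrite ger0_norm ?subr_ge0 ?sum_mass_le//.
suff : mass w <= \sum_(i < J) mass ((i : nat) :: w) + e / 2 by lra.
have H : \sum_(i < J) mean (m n) (\1_(cell ((i : nat) :: w))) + e / 2 @[n --> U]
    --> \sum_(i < J) mass ((i : nat) :: w) + e / 2.
  by apply: cvgD; [exact: sum_mass_cvg|exact: cvg_cst].
apply: (@ulim_le _ _ _ _ (@mass_cvg w) H) => n.
have bc : bounded_borel (cover_fun c (rr (size w) / 4) J).
  by apply: lip01_bb; exact: cover_lip01.
have bc0 : bounded_borel (cover_fun c (rr (size w) / 4) J0).
  by apply: lip01_bb; exact: cover_lip01.
have := le_mean (m n) (cellbb w) (bbD (@bbsum w J) (bbB (bb_cst 1) bc)) (@cell_sum_ge w J).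
rewrite meanD//; last exact: (bbB (bb_cst 1) bc).
rewrite (mean_sum (m n) (index_enum 'I_J) (fun i : 'I_J => cellbb ((i : nat) :: w))).
rewrite meanB ?mean_cst//; last exact: bb_cst.
have := HJ0 n; have := le_mean (m n) bc0 bc (fun x => cover_mono c _ x J0J).
lra.
Qed.

(** Finitely many cells carry nearly all the mass at each scale; half of the error is spent on the
    last letter and half on the shorter words. *)
Lemma words_mass k e : 0 < e -> exists s : seq (seq nat),
  [/\ uniq s, forall w, w \in s -> size w = k & 1 - e <= \sum_(w <- s) mass w].
Proof.
elim: k e => [|k IH] e e0.
  exists [:: [::]]; split => //; first by move=> w; rewrite inE => /eqP ->.
  by rewrite big_seq1 mass_nil; lra.
have [s [us ss Hs]] := IH (e / 2) ltac:(lra).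
have H : \sum_(w <- s) \sum_(i < J) mass ((i : nat) :: w) @[J --> \oo]
    --> \sum_(w <- s) mass w.
  elim: (s) => [|w s' IHs]; first by rewrite big_nil; under eq_fun do rewrite big_nil; exact: cvg_cst.
  rewrite big_cons; under eq_fun do rewrite big_cons.
  by apply: cvgD => //; exact: sum_mass_cvgn.
have [J _ /(_ J (leqnn _)) HJ] := cvgr_gt _ H (\sum_(w <- s) mass w - e / 2) ltac:(lra).
exists [seq i :: w | w <- s, i <- iota 0 J]; split.
- by apply: allpairs_uniq => //; [exact: iota_uniq|move=> [w i] [w' i'] _ _ /= [-> ->]].
- by move=> w' /allpairsP[[w i] [/= /ss <- _ ->]].
- rewrite big_allpairs_dep /=.
  have -> : \sum_(w <- s) \sum_(i <- iota 0 J) mass (i :: w) =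
      \sum_(w <- s) \sum_(i < J) mass ((i : nat) :: w).
    apply: eq_bigr => w _.
    by rewrite -(big_mkord xpredT (fun i => mass (i :: w))) /index_iota subn0.
  lra.
Qed.

End limit.
End limit_measure.

(** * Coding a consistent mass function on words by nested intervals *)

Section intervals.
Context {R : realType}.
Variable p : seq nat -> R.
Hypotheses (p0 : forall w, 0 <= p w) (p1 : p [::] = 1).
Hypothesis p_split : forall w, \sum_(i < J) p ((i : nat) :: w) @[J --> \oo] --> p w.

(** The extensions [i :: w] occupy consecutive intervals of lengths [p (i :: w)] from the left end
    of [w] on; half-open intervals make this a partition. *)
Fixpoint left_end (w : seq nat) : R :=
  if w is i :: w' then left_end w' + \sum_(l < i) p ((l : nat) :: w') else 0.

Definition word_itv w : set R := `[left_end w, left_end w + p w[%classic.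

Lemma word_itvE w u : word_itv w u = (left_end w <= u < left_end w + p w).
Proof. by rewrite /word_itv /= in_itv. Qed.

Lemma partial_sum_le w J : \sum_(i < J) p ((i : nat) :: w) <= p w.
Proof.
have nd : nondecreasing_seq (fun J => \sum_(i < J) p ((i : nat) :: w)).
  by apply/nondecreasing_seqP => n; rewrite big_ord_recr /= lerDl.
have cv : cvgn (fun J => \sum_(i < J) p ((i : nat) :: w)).
  by apply/cvg_ex; exists (p w); exact: (@p_split w).
by have := nondecreasing_cvgn_le nd cv J; rewrite (cvg_lim _ (@p_split w)).
Qed.

Lemma word_itv_sub i w : word_itv (i :: w) `<=` word_itv w.
Proof.
move=> u; rewrite !word_itvE /= => /andP[u1 u2].
have s0 : 0 <= \sum_(l < i) p ((l : nat) :: w) by apply: sumr_ge0.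
have := partial_sum_le w i.+1; rewrite big_ord_recr /=; lra.
Qed.

Lemma word_itv_split w u : word_itv w u -> exists i, word_itv (i :: w) u.
Proof.
rewrite word_itvE => /andP[u1 u2].
have uw : u - left_end w < p w by lra.
have [J0 _ /(_ J0 (leqnn _)) HJ0] := cvgr_gt _ (@p_split w) _ uw.
pose P J := u - left_end w < \sum_(i < J) p ((i : nat) :: w).
(* The least number of summands exceeding the offset of [u] is a successor [J.+1], the empty sum
   being too small; [u] then lies in the child [J]. *)
have [[|J] HJ Jmin] := ex_minnP (ex_intro P J0 HJ0).
  by move: HJ; rewrite /P big_ord0; lra.
exists J; rewrite word_itvE /=; apply/andP; split.
  have : ~~ P J by apply/negP => /Jmin; rewrite ltnn.
  by rewrite /P -leNgt; lra.
by move: HJ; rewrite /P big_ord_recr /=; lra.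
Qed.

Lemma partial_sum_mono w i j : (i <= j)%N ->
  \sum_(l < i) p ((l : nat) :: w) <= \sum_(l < j) p ((l : nat) :: w).
Proof.
move=> /subnKC <-; elim: (j - i)%N => [|k IH]; first by rewrite addn0.
by rewrite addnS big_ord_recr /= (le_trans IH)// lerDl.
Qed.

Lemma word_itv_unique w w' u : size w = size w' ->
  word_itv w u -> word_itv w' u -> w = w'.
Proof.
elim: w w' => [|i w IH] [|j w']//= [sw] iu ju.
have ww : w = w' by apply: IH => //; apply: word_itv_sub; [exact: iu|exact: ju].
rewrite -ww in ju *; congr cons.
move: iu ju; rewrite !word_itvE /= => /andP[i1 i2] /andP[j1 j2].
case: (ltngtP i j) => // lt.
  exfalso; have := partial_sum_mono w lt; rewrite big_ord_recr /= => H; clear sw lt ww; lra.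
exfalso; have := partial_sum_mono w lt; rewrite big_ord_recr /= => H; clear sw lt ww; lra.
Qed.

Lemma word_itv_nil : word_itv [::] = `[0, 1[%classic.
Proof. by rewrite /word_itv /= p1 add0r. Qed.

Lemma word_itv_mass w : lebesgue_measure (word_itv w : set (measurableTypeR R)) = (p w)%:E.
Proof.
rewrite /word_itv lebesgue_measure_itv /= lte_fin ltrDl.
have [_|pw] := ltP 0 (p w); first by rewrite -EFinB addrC addKr.
by congr EFin; apply/eqP; rewrite eq_le p0.
Qed.

Lemma word_itv_measurable w : measurable (word_itv w : set (measurableTypeR R)).
Proof. exact: measurable_itv. Qed.

Lemma word_itv_unit w : word_itv w `<=` `[0, 1[%classic.
Proof.
rewrite -word_itv_nil; elim: w => // i w IH.
by apply: subset_trans IH; exact: word_itv_sub.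
Qed.

Lemma coding : exists code : R -> nat -> seq nat, forall u, `[0, 1[%classic u ->
  forall k, [/\ size (code u k) = k, word_itv (code u k) u &
    forall l, (k <= l)%N -> exists v, code u l = v ++ code u k].
Proof.
have step (q : R * seq nat) : exists i, word_itv q.2 q.1 -> word_itv (i :: q.2) q.1.
  have [H|H] := pselect (word_itv q.2 q.1); last by exists 0%N.
  by have [i Hi] := word_itv_split H; exists i.
have [nxt Hnxt] := choice step.
pose code := fix code u k := if k is k'.+1 then nxt (u, code u k') :: code u k' else [::].
exists code => u u01 k.
have H j : size (code u j) = j /\ word_itv (code u j) u.
  elim: j => [|j [IH1 IH2]]; first by rewrite word_itv_nil.
  by split; [rewrite /= IH1|exact: (Hnxt (u, code u j) IH2)].
split; [exact: (H k).1|exact: (H k).2|].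
move=> l /subnKC <-; elim: (l - k)%N => [|j [v IH]]; first by exists [::]; rewrite addn0.
by rewrite addnS; exists (nxt (u, code u (k + j)%N) :: v); rewrite /= IH.
Qed.

End intervals.

(** * Image of Lebesgue measure on the unit interval *)

Section unit_law.
Context {R : realType} {X : pmetricType R}.
Variable T : measurableTypeR R -> borel X.
Hypothesis mT : measurable_fun setT T.

(** The measurability proof is an argument so that the measure structure can be attached to this
    function. *)
Definition unit_law of measurable_fun setT T : set (borel X) -> \bar R :=
  pushforward (mrestr lebesgue_measure (measurable_itv `[(0 : R), 1[)) T.

Let law_fun := unit_law mT.

Let mpre A : measurable A -> measurable (T @^-1` A).
Proof. by move=> mA; rewrite -[X in measurable X]setTI; exact: mT. Qed.

Let unit_law0 : law_fun set0 = 0%E.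
Proof. by rewrite /law_fun /unit_law /pushforward preimage_set0 measure0. Qed.

Let unit_law_ge0 A : (0 <= law_fun A)%E.
Proof. exact: measure_ge0. Qed.

Let unit_law_additive : semi_sigma_additive law_fun.
Proof.
move=> F mF tF mUF; rewrite /law_fun /unit_law /pushforward preimage_bigcup.
apply: measure_semi_sigma_additive.
- by move=> n; exact: mpre.
- apply/trivIsetP => /= i j _ _ ij; rewrite -preimage_setI.
  by move/trivIsetP : tF => /(_ _ _ _ _ ij) ->//; rewrite preimage_set0.
- by rewrite -preimage_bigcup; exact: mpre.
Qed.

HB.instance Definition _ := isMeasure.Build _ (borel X) R (unit_law mT)
  unit_law0 unit_law_ge0 unit_law_additive.

Lemma unit_lawT : unit_law mT setT = 1%E.
Proof.
rewrite /unit_law /pushforward preimage_setT /mrestr setTI lebesgue_measure_itv /=.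
by rewrite lte_fin ltr01 oppr0 adde0.
Qed.

Let unit_law_fin : fin_num_fun (unit_law mT).
Proof.
move=> A mA; rewrite ge0_fin_numE//; apply: (@le_lt_trans _ _ (unit_law mT setT)).
  by apply: le_measure; rewrite ?inE//; exact: measurableT.
by rewrite unit_lawT ltry.
Qed.

HB.instance Definition _ := @Measure_isFinite.Build _ (borel X) R (unit_law mT) unit_law_fin.

(** After change of variables, a step function on the unit interval lies below [f] composed with
    [T]; the restriction to the unit interval does not change the measure of [B i]. *)
Lemma unit_law_ge (I : Type) (s : seq I) (B : I -> set (measurableTypeR R)) (a : I -> R)
    (f : X -> R) :
  bounded_borel f -> (forall x, 0 <= f x) -> (forall i, measurable (B i)) ->
  (forall i, B i `<=` `[0, 1[%classic) -> (forall i, 0 <= a i) ->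
  (forall u, \sum_(i <- s) a i * \1_(B i) u <= f (T u)) ->
  (\sum_(i <- s) (a i)%:E * lebesgue_measure (B i) <= integ (unit_law mT) f)%E.
Proof.
move=> bf f0 mB Bu a0 H; rewrite /integ.
have mf : measurable_fun setT (EFin \o (f : borel X -> R)).
  by have /integrableP[] := bb_integrable (unit_law mT) bf.
pose mr := mrestr lebesgue_measure (measurable_itv `[(0 : R), 1[).
have -> : (\int[unit_law mT]_x (f x)%:E)%E = (\int[mr]_u (f (T u))%:E)%E.
  rewrite /unit_law ge0_integral_pushforward//.
  by move=> y _; rewrite lee_fin.
have mi i : measurable_fun setT (fun u => (a i * \1_(B i) u)%:E : \bar R).
  by apply/measurable_EFinP; apply: measurable_funM => //; exact: measurable_indic.
have i0 i u : (0 <= (a i * \1_(B i) u)%:E)%E by rewrite lee_fin mulr_ge0.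
apply: (@le_trans _ _ (\int[mr]_u (\sum_(i <- s) (a i * \1_(B i) u)%:E))%E); last first.
  apply: ge0_le_integral => //.
  - by move=> u _; apply: sume_ge0.
  - by apply: emeasurable_sum.
  - exact: measurableT_comp mf mT.
  - by move=> u _; rewrite sumEFin lee_fin.
rewrite ge0_integral_sum//.
apply: lee_sum => i _.
under eq_integral do rewrite EFinM.
rewrite ge0_integralZl_EFin//; last by apply/measurable_EFinP; exact: measurable_indic.
have E : mr (B i) = lebesgue_measure (B i) by rewrite /mr /mrestr (setIidl (Bu i)).
by rewrite -E integral_indic// setIT.
Qed.

End unit_law.

(** * Realisation of the ultrafilter limit as a measure *)

Section limit.
Context {R : realType} {X : pmetricType R}.
Implicit Types (f g : X -> R) (x y : X) (w : seq nat).
Local Notation d := (@mdist R X).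
Variables (c : nat -> X) (m : nat -> fmeasure X R).
Hypothesis cX : complete_metric (X := X).
Hypothesis pm : forall n, is_prob (m n).
Hypothesis tm : forall eps a, 0 < eps -> 0 < a ->
  exists J, forall n, 1 - eps <= mean (m n) (cover_fun c a J).
Variable U : set_system nat.
Hypothesis UU : UltraFilter U.

Local Notation p := (mass c m U).
Local Notation rr k := ((2 ^+ k)^-1 : R).
Local Notation cell := (cell (R := R) c).
Local Notation word_itv := (word_itv p).

Let p0 w : 0 <= p w. Proof. exact: mass_ge0. Qed.
Let p1 : p [::] = 1. Proof. exact: mass_nil. Qed.
Let ps w : \sum_(i < J) p ((i : nat) :: w) @[J --> \oo] --> p w.
Proof. exact: sum_mass_cvgn. Qed.

Let ctr w := c (head 0%N w).

Lemma cell_cat v w : cell (v ++ w) `<=` cell w.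
Proof. by elim: v => //= i v IH x [/IH]. Qed.

Lemma cell_ctr w k x : size w = k.+1 -> cell w x -> d (ctr w) x < rr k.
Proof.
by case: w => //= i w [<-] [_ [ix _]]; move: ix; rewrite ballEmdist.
Qed.

(* The cells coded by the intervals around u are nested with diameters tending
   to 0, so their centres converge. *)
Lemma decoding : exists T : R -> X,
  (forall u, ~ `[0, 1[%classic u -> T u = c 0%N) /\
  (forall u w k, size w = k.+1 -> word_itv w u -> d (ctr w) (T u) <= 2 * rr k).
Proof.
have [code Hcode] := coding p1 (@ps).
have step (u : R) : exists t : X, (~ `[0, 1[%classic u -> t = c 0%N) /\
    (`[0, 1[%classic u -> forall k, d (ctr (code u k.+1)) t <= 2 * rr k).
  have [u01|nu] := pselect (`[0, 1[%classic u); last by exists (c 0%N).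
  have close k l : (k <= l)%N -> d (ctr (code u k.+1)) (ctr (code u l.+1)) < 2 * rr k.
    move=> kl; have [sk _ Hk] := Hcode u u01 k.+1.
    have [sl Il _] := Hcode u u01 l.+1; have [v Ev] := Hk l.+1 kl.
    (* An interval containing [u] has positive length, so its cell has positive mass and contains a
       point; that point links the two centres. *)
    have pl : 0 < p (code u l.+1).
      by move: Il; rewrite word_itvE => /andP[a1 a2]; lra.
    have [x xl] := mass_gt0 UU pl.
    have xk : cell (code u k.+1) x by move: xl; rewrite Ev => /cell_cat.
    have := cell_ctr sk xk; have := cell_ctr sl xl; have := rr_le (R := R) kl.
    have := metric_triangle (ctr (code u k.+1)) x (ctr (code u l.+1)).
    rewrite (metric_sym x); lra.
  have [t Ht] : exists t, forall e, 0 < e -> exists N, forall n, (N <= n)%N ->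
      d (ctr (code u n.+1)) t < e.
    apply: complete_seq => // e e0; have [N HN] := rr_small (divr_gt0 e0 (ltr0n R 4)).
    exists N => k l Nk Nl; have := close _ _ Nk; have := close _ _ Nl.
    have := metric_triangle (ctr (code u k.+1)) (ctr (code u N.+1)) (ctr (code u l.+1)).
    rewrite (metric_sym (ctr (code u k.+1)) (ctr (code u N.+1))); lra.
  exists t; split => // _ k; apply/ler_addgt0Pr => e e0.
  have [N HN] := Ht e e0; have := HN (maxn N k) (leq_maxl _ _).
  have := close k (maxn N k) (leq_maxr _ _).
  have := metric_triangle (ctr (code u k.+1)) (ctr (code u (maxn N k).+1)) t; lra.
have [T HT] := choice step.
exists T; split=> [u|u w k sw Iw]; first exact: (HT u).1.
have u01 := word_itv_unit p0 p1 (@ps) Iw.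
have [sk Ik _] := Hcode u u01 k.+1.
have -> : w = code u k.+1 by apply: (word_itv_unique p0 (@ps)) Iw Ik; rewrite sk.
exact: (HT u).2.
Qed.

Lemma limit_measure : exists mus : fmeasure X R, is_prob mus /\
  forall f, lip01 f -> mean (m n) f @[n --> U] --> mean mus f.
Proof.
have [T [T0 TI]] := decoding.
have [code Hcode] := coding p1 (@ps).
have mT : measurable_fun setT (T : measurableTypeR R -> borel X).
  apply: (@measurability _ _ (measurableTypeR R) (borel X) setT T (@open X)) => //.
  move=> _ [ O oO <-]; rewrite setTI.
  (* Words whose whole interval is sent into [O] because the closed ball known to contain its image
     lies in [O]. There are countably many words, so the preimage of [O] is measurable. *)
  pose good := [set w : seq nat | size w != 0%N /\ forall y, d (ctr w) y <= 2 * rr (size w).-1 -> O y].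
  have -> : T @^-1` O = (\bigcup_(w in good) word_itv w) `|`
      (if `[< O (c 0%N) >] then ~` `[0, 1[%classic else set0).
    apply/seteqP; split=> u /=.
      move=> Ou; have [u01|nu] := pselect (`[0, 1[%classic u); last first.
        by right; case: asboolP => //; rewrite -(T0 u nu).
      left; have [e /= e0 He] := (metricType_numDomainType.nbhs_mdistP (T u) O).1
        (open_nbhs_nbhs (conj oO Ou)).
      (* Both [T u] and the competing point are within [2 * rr k] of the centre, so [4 * rr k < e]
         suffices. *)
      have [k Hk] := rr_small (divr_gt0 e0 (ltr0n R 4)).
      have [sk Ik _] := Hcode u u01 k.+1; exists (code u k.+1) => //.
      rewrite /good /mkset sk; split => // y cy; apply: He => /=.
      have := TI u _ k sk Ik; have := metric_triangle (T u) (ctr (code u k.+1)) y.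
      rewrite (metric_sym (T u) (ctr _)); have {}Hk : rr k < e / 4 := Hk; have : d (ctr (code u k.+1)) y <= 2 * rr k := cy.
      lra.
    case=> [[w [sw Hw] Iw]|].
      by apply: Hw; apply: (TI u w) => //; rewrite prednK// lt0n.
    by case: asboolP => // Oc nu; rewrite T0.
  apply: measurableU; last first.
    case: asboolP => _; last exact: measurable0.
    by apply: measurableC; exact: measurable_itv.
  by rewrite bigcup_mkcond; apply: countable_bigcupT_measurable => // w; case: ifP => _;
    [exact: word_itv_measurable|exact: measurable0].
pose mus : fmeasure X R := unit_law mT.
have pmus : is_prob mus by exact: unit_lawT.
exists mus; split => //.
(* One inequality is enough: applied to [1 - f] it gives the reverse one. *)
suff key f l : lip01 f -> mean (m n) f @[n --> U] --> l -> l <= mean mus f.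
  move=> f lf; have bf := lip01_bb lf; have f01 : forall x, 0 <= f x <= 1 by case: lf.
  have [l Hl] := ultra_cvg01 UU (fun n => mean01 pm n bf f01).
  suff -> : mean mus f = l by [].
  apply/eqP; rewrite eq_le (key _ _ lf Hl) andbT.
  have H1 : mean (m n) (fun x => 1 - f x) @[n --> U] --> 1 - l.
    have -> : (fun n => mean (m n) (fun x => 1 - f x)) = (fun n => 1 - mean (m n) f).
      by apply/funext => n; rewrite meanB ?mean_cst//; exact: bb_cst.
    by apply: cvgB => //; exact: cvg_cst.
  have := key _ _ (lip01_onem lf) H1; rewrite meanB ?mean_cst//; last exact: bb_cst.
  by lra.
move=> lf Hl; have bf := lip01_bb lf.
have [f01 /lipschitz_ge1[L L1 fL]] := lf.
have L0 : 0 < L by lra.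
apply/ler_addgt0Pr => e e0.
have [k Hk] := rr_small (divr_gt0 e0 (mulr_gt0 (ltr0n R 6) L0)).
have {}Hk : 3 * L * rr k < e / 2.
  by move: Hk; rewrite ltr_pdivlMr ?mulr_gt0//; lra.
have [s [us ss Hs]] := words_mass pm tm UU k.+1 (divr_gt0 e0 (ltr0n R 2)).
(* A lower bound for [f] on the image of the interval of [w], whose points are within [2 * rr k] of
   the centre; the maximum with 0 keeps the coefficients nonnegative. *)
pose a w := Num.max 0 (f (ctr w) - 2 * L * rr k).
have low : \sum_(w <- s) a w * p w <= mean mus f.
  have : (\sum_(w <- s) (if size w == k.+1 then a w else 0)%:E *
      lebesgue_measure (word_itv w : set (measurableTypeR R)) <= integ mus f)%E.
    apply: unit_law_ge => //.
    - by move=> x; case/andP: (f01 x).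
    - by move=> w; exact: word_itv_measurable.
    - by move=> w; exact: (word_itv_unit p0 p1 (@ps)).
    - by move=> w; case: ifP => // _; rewrite le_max lexx.
    move=> u; under eq_bigr do rewrite mulrC indicE.
    have [i j si sj|[-> _]|[w [sw Iw ->]]] := sum_unique (P := fun w => u \in word_itv w)
      (fun w => if size w == k.+1 then a w else 0) us.
    - rewrite !inE => Ii Ij; apply: (word_itv_unique p0 (@ps)) Ii Ij.
      by rewrite !ss.
    - by case/andP: (f01 (T u)).
    - rewrite (ss w sw) eqxx ge_max; have /andP[-> _] := f01 (T u) => /=.
      have := TI u w k (ss w sw) (set_mem Iw); have := fL (ctr w) (T u).
      rewrite ler_norml => H1 H2; have : L * d (ctr w) (T u) <= L * (2 * rr k) by rewrite ler_pM2l.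
      lra.
  rewrite integE// => H; rewrite -lee_fin; apply: le_trans H.
  rewrite -sumEFin le_eqVlt; apply/orP; left; apply/eqP.
  apply: eq_big_seq => w sw; rewrite (ss w sw) eqxx EFinM; congr (_ * _)%E.
  by rewrite (word_itv_mass p0).
(* On a listed cell [f] is at most [f (ctr w) + L * rr k], hence at most [a w + 3 * L * rr k]; off
   the listed cells it is at most 1, paid by the missing mass. *)
have up : l <= \sum_(w <- s) a w * p w + 3 * L * rr k + (1 - \sum_(w <- s) 1 * p w).
  pose S1 n := \sum_(w <- s) a w * mean (m n) (\1_(cell w)).
  pose S2 n := \sum_(w <- s) 1 * mean (m n) (\1_(cell w)).
  have H : S1 n + 3 * L * rr k + (1 - S2 n) @[n --> U] -->
      \sum_(w <- s) a w * p w + 3 * L * rr k + (1 - \sum_(w <- s) 1 * p w).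
    apply: cvgD.
      by apply: cvgD; [exact: (cvg_sum_mean pm UU)|exact: cvg_cst].
    by apply: cvgB; [exact: cvg_cst|exact: (cvg_sum_mean pm UU)].
  apply: (@ulim_le _ _ UU _ _ _ _ Hl H) => n.
  have bc w : bounded_borel (\1_(cell w) : X -> R).
    by apply: bb_indic; exact: cell_borel.
  have bS (b : seq nat -> R) : bounded_borel (fun x => \sum_(w <- s) b w * \1_(cell w) x).
    by apply: bb_sum => w; exact: bbZ.
  have E (b : seq nat -> R) : \sum_(w <- s) b w * mean (m n) (\1_(cell w)) =
      mean (m n) (fun x => \sum_(w <- s) b w * \1_(cell w) x).
    rewrite (mean_sum (m n) s (fun w => bbZ (b w) (bc w))).
    by apply: eq_bigr => w _; rewrite meanZ.
  rewrite /S1 /S2 !E.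
  have -> : mean (m n) (fun x => \sum_(w <- s) a w * \1_(cell w) x) + 3 * L * rr k +
      (1 - mean (m n) (fun x => \sum_(w <- s) 1 * \1_(cell w) x)) =
    mean (m n) (fun x => \sum_(w <- s) a w * \1_(cell w) x + 3 * L * rr k +
      (1 - \sum_(w <- s) 1 * \1_(cell w) x)).
    rewrite meanD; [|by apply: bbD => //; exact: bb_cst|by apply: bbB => //; exact: bb_cst].
    rewrite meanD//; last exact: bb_cst.
    by rewrite meanB// ?mean_cst//; exact: bb_cst.
  apply: le_mean => //.
    by apply: bbD; [apply: bbD => //; exact: bb_cst|apply: bbB => //; exact: bb_cst].
  move=> x; have r0 : 0 <= 3 * L * rr k.
    by rewrite mulr_ge0 ?invr_ge0 ?exprn_ge0//; lra.
  have eqs (b : seq nat -> R) : \sum_(w <- s) b w * \1_(cell w) x =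
      \sum_(w <- s) (x \in cell w)%:R * b w.
    by apply: eq_bigr => w _; rewrite mulrC indicE.
  rewrite !eqs; have un i j : i \in s -> j \in s -> x \in cell i -> x \in cell j -> i = j.
    by move=> si sj; rewrite !inE => xi xj; apply: (cell_unique _ xi xj); rewrite !ss.
  have [[E0 nP]|[w [sw xw Ew]]] := sum_unique (P := fun w => x \in cell w) a us un.
    have [[E1 _]|[w [sw xw _]]] :=
      @sum_unique R _ s (fun w => x \in cell w) (fun=> 1) us un.
      by rewrite E0 E1; have := f01 x; lra.
    by have := nP w sw; rewrite xw.
  have [[_ nP]|[w' [_ _ E1]]] :=
    @sum_unique R _ s (fun w => x \in cell w) (fun=> 1) us un.
    by have := nP w sw; rewrite xw.
  rewrite Ew E1; have : f (ctr w) - 2 * L * rr k <= a w by rewrite /a le_max lexx orbT.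
  have := cell_ctr (ss w sw) (set_mem xw); have := fL x (ctr w).
  rewrite ler_norml (metric_sym x) => H1 H2.
  have : L * d (ctr w) x <= L * rr k by rewrite ler_pM2l// ltW.
  lra.
have : \sum_(w <- s) 1 * p w = \sum_(w <- s) p w.
  by apply: eq_bigr => w _; rewrite mul1r.
lra.
Qed.

End limit.

(** * Asymptotic stability *)

Section stability.
Context {R : realType} {X : pmetricType R}.
Context {Pm : R -> fmeasure X R -> fmeasure X R} {Pf : R -> (X -> R) -> (X -> R)}.
Hypothesis MF : markov_feller Pm Pf.
Hypothesis PX : polish (X := X).
Implicit Types (mu nu : fmeasure X R) (f g : X -> R) (x y z : X).
Local Notation law n x := (@law R X Pm n%:R x).
Local Notation PP n := (Pf n%:R).

Lemma limf_esup0 (T : choiceType) (Y : filteredType T) (F : set_system Y) (g : Y -> R) :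
  ProperFilter F -> (forall t, 0 <= g t) -> g t @[t --> F] --> (0 : R) ->
  limf_esup (fun t => (g t)%:E) F = 0%E.
Proof.
move=> FF g0 gF; apply/eqP; rewrite eq_le; apply/andP; split; last first.
  by apply: limf_esup_ge0 => [|t]; [exact: filter_not_empty|rewrite lee_fin].
apply/lee_addgt0Pr => e e0; rewrite add0e limf_esupE.
have FF' : Filter F := @filter_filter _ F FF.
have H : \forall t \near F, `|0 - g t| < e by exact: (cvgrPdist_lt _ _).1 gF e e0.
apply: (@le_trans _ _ (ereal_sup [set (g t)%:E | t in [set t | g t < e]])).
  apply: ereal_inf_lbound; exists [set t | g t < e] => //.
  by apply: (@filterS _ F FF' _ _ _ H) => t /=; rewrite sub0r normrN ger0_norm.
by apply: ge_ereal_sup => _ [t /= te <-]; rewrite lee_fin ltW.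
Qed.

Lemma stable_cvg mus mu f : (forall mu, is_prob mu -> weak_cvg_pinfty (fun t => Pm t mu) mus) ->
  is_prob mu -> bounded_continuous f -> mean (Pm t mu) f @[t --> +oo] --> mean mus f.
Proof.
move=> H pmu bf; have := H mu pmu f bf; rewrite (integE _ (bc_bb bf)).
by move=> /fine_cvg.
Qed.

Lemma stable_implies : asymptotically_stable Pm ->
  (forall z, eventually_continuous_at Pf z) /\ exists z, lower_bound_cond Pm z.
Proof.
move=> [mus [pmus _ _ Hw]].
have cv f x : bounded_lipschitz f -> Pf t f x @[t --> +oo] --> mean mus f.
  move=> [bf lf]; have bc : bounded_continuous f by split => //; exact: lipschitz_cts.
  apply: cvg_trans (stable_cvg Hw (dirac_prob x) bc); apply: near_eq_cvg.
  near=> t; have t0 : 0 <= t by near: t; exact: nbhs_pinfty_ge.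
  by rewrite -(mean_law MF _ t0 (bc_bb bc)).
split.
  move=> z f bl.
  (* Both orbits converge to the same constant [mean mus f], so the inner limsup vanishes for every
     [x]. *)
  have E x : limf_esup (fun t => (`|Pf t f x - Pf t f z|)%:E) (pinfty_nbhs R) = 0%E.
    have H : `|Pf t f x - Pf t f z| @[t --> +oo] --> `|mean mus f - mean mus f|.
      by apply: cvg_norm; apply: cvgB; exact: cv.
    by rewrite subrr normr0 in H; exact: limf_esup0.
  under eq_fun do rewrite E.
  by apply: (@limf_esup0 _ _ _ (fun=> 0)) => //; exact: cvg_cst.
have [c dc] := separable_seq PX.2.
have [z Hz] := support_point dc pmus.
(* Portmanteau on the open ball around a support point gives half of its [mus]-mass as a lower bound
   from every starting point. *)
exists z => eps eps0.
have mB := ball_borel z eps; have bB := bb_indic mB.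
have m0 : 0 < mean mus (\1_(ball z eps)).
  rewrite lt_neqAle; apply/andP; split.
    apply/eqP => e0; apply: (Hz eps eps0).
    by apply: etrans (measure_mean mus mB) _; rewrite -e0.
  rewrite -[leLHS](@mean_cst _ _ mus 0 pmus); apply: le_mean => //; first exact: bb_cst.
apply: (@lt_le_trans _ _ (mean mus (\1_(ball z eps)) / 2)%:E).
  by rewrite lte_fin divr_gt0.
apply: le_ereal_inf_tmp => _ [x _ <-].
have H f : lip01 f -> mean (Pm t (\d_(x : borel X))) f @[t --> +oo] --> mean mus f.
  by move=> lf; apply: (stable_cvg Hw (dirac_prob x)); exact: lip01_bc.
have lt2 : mean mus (\1_(ball z eps)) / 2 < mean mus (\1_(ball z eps)) by lra.
pose V := [set t | mean mus (\1_(ball z eps)) / 2 < mean (Pm t (\d_(x : borel X))) (\1_(ball z eps))].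
have oV : pinfty_nbhs R V.
  exact: (portmanteau_lsc H bB (indic01 (ball z eps)) (open_lsc (open_mball z eps)) lt2).
rewrite limf_einfE; apply: (@le_trans _ _ (ereal_inf [set trans Pm t x (ball z eps) | t in V])); last first.
  by apply: ereal_sup_ubound; exists V.
apply: le_ereal_inf_tmp => _ [t Vt <-].
by rewrite /trans (measure_mean _ mB) lee_fin ltW.
Unshelve. all: by end_near. Qed.

(** * Invariant measure and convergence from the lower bound condition *)

Section existence.
Variable z : X.
Hypotheses (ECz : eventually_continuous_at Pf z) (LBz : lower_bound_cond Pm z).

(** The limit measure is fixed by one step since the orbits of [z] and of its one-step law merge,
    hence by all integer times; merging then extends invariance to real times. *)
Lemma exists_invariant : exists2 mus : fmeasure X R, is_prob mus & invariant Pm mus.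
Proof.
have [c dc] := separable_seq PX.2.
have tm eps a : 0 < eps -> 0 < a ->
    exists J, forall n, 1 - eps <= mean (law n z) (cover_fun c a J).
  exact: (tight MF ECz LBz PX.1 dc).
have [U [UU ooU]] := ultraFilterLemma (@eventually_filter : ProperFilter \oo).
have [mus [pmus Hmus]] := limit_measure PX.1 (fun n => law1 MF n z) tm UU.
have inv1 f : lip01 f -> mean (Pm 1 mus) f = mean mus f.
  move=> lf; have bf := lip01_bb lf; have f01 : forall x, 0 <= f x <= 1 by case: lf.
  have c1 : continuous (PP 1 f) by apply: (Pf_cts MF (ler0n _ _)); exact: lip01_bc.
  have p1 := Pf01 MF (ler0n R 1) bf f01.
  have L1 : mean (law n z) (PP 1 f) @[n --> U] --> mean mus (PP 1 f).
    exact: (portmanteau01 Hmus (fun n => law1 MF n z) pmus c1 p1).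
  (* The difference compares the orbits started from [law 1 z] and from [z]; it tends to 0 along the
     integers, hence along [U]. *)
  have L2 : mean (law n z) (PP 1 f) - mean (law n z) f @[n --> U] --> (0 : R).
    have D : mean (law n z) (PP 1 f) - mean (law n z) f @[n --> \oo] --> (0 : R).
      have -> : (fun n => mean (law n z) (PP 1 f) - mean (law n z) f) =
          (fun n => mean (Pm n%:R (law 1 z)) f - PP n f z).
        apply/funext => n; rewrite -(mean_lawS MF)// addnC (mean_lawS MF)// -(mean_Pm MF)//.
        by rewrite (mean_law MF).
      exact: ((cvg_pinftyP _ _).1 (merge_point MF ECz LBz z (law1 MF 1 z) lf) _ (cvgr_idn (R := R))).
    by apply: cvg_trans D => B HB; apply: ooU; exact: HB.
  have L3 : mean (law n z) (PP 1 f) @[n --> U] --> mean mus f.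
    have -> : (fun n => mean (law n z) (PP 1 f)) = (fun n =>
        (mean (law n z) (PP 1 f) - mean (law n z) f) + mean (law n z) f).
      by apply/funext => n; rewrite subrK.
    by rewrite -[X in _ --> X]add0r; apply: cvgD L2 _; exact: Hmus.
  rewrite (mean_Pm MF)//.
  exact: (cvg_unique _ L1 L3).
have P1 : is_prob (Pm 1 mus) by exact: (Pm_prob MF ler01 pmus).
have eq1 := measure_eq_lip P1 pmus inv1.
have invn n g : bounded_borel g -> mean mus (PP n g) = mean mus g.
  move=> bg; elim: n => [|n IH].
    rewrite -(mean_Pm MF)//; apply: eq_mean => A mA.
    by case: MF => _ _ [H _] _ _; rewrite H.
  rewrite -addn1 natrD addrC (Pf_add MF)// -(mean_Pm MF)//; last exact: (Pf_bb MF).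
  by rewrite (eq_mean _ eq1).
exists mus => // s A s0 mA.
have ps : is_prob (Pm s mus) by exact: (Pm_prob MF s0 pmus).
apply: measure_eq_lip mA => // f lf; have bf := lip01_bb lf.
(* Integer times fix the means of both [Pm s mus] and [mus], so a difference that tends to 0 is
   constant. *)
have H := (cvg_pinftyP _ _).1 (merge MF ECz LBz ps pmus lf) _ (cvgr_idn (R := R)).
have E : (fun n => mean (Pm n%:R (Pm s mus)) f - mean (Pm n%:R mus) f) =
    fun=> mean (Pm s mus) f - mean mus f.
  apply/funext => n; have bn := Pf_bb MF (ler0n R n) bf; have bs := Pf_bb MF s0 bf.
  rewrite (mean_Pm MF _ (ler0n R n) bf) (mean_Pm MF _ s0 bn) (mean_Pm MF _ (ler0n R n) bf).
  rewrite -(Pf_add MF s0 (ler0n R n) bf) (addrC s) (Pf_add MF (ler0n R n) s0 bf) !invn//.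
  by rewrite (mean_Pm MF _ s0 bf).
rewrite E in H; apply/eqP; rewrite -subr_eq0; apply/eqP.
have C : mean (Pm s mus) f - mean mus f @[_ --> \oo] --> mean (Pm s mus) f - mean mus f.
  exact: cvg_cst.
exact: (cvg_unique _ C H).
Qed.

Lemma stable_of_lower_bound : asymptotically_stable Pm.
Proof.
have [mus pmus imus] := exists_invariant; exists mus.
have inv nu t f : invariant Pm nu -> 0 <= t -> mean (Pm t nu) f = mean nu f.
  by move=> inu t0; apply: eq_mean => A mA; exact: inu.
have cv mu f : is_prob mu -> lip01 f -> mean (Pm t mu) f @[t --> +oo] --> mean mus f.
  move=> pmu lf; have H := merge MF ECz LBz pmu pmus lf.
  have H2 : mean (Pm t mu) f - mean (Pm t mus) f + mean mus f @[t --> +oo] --> 0 + mean mus f.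
    by apply: cvgD => //; exact: cvg_cst.
  rewrite add0r in H2; apply: cvg_trans H2; apply: near_eq_cvg.
  near=> t; have t0 : 0 <= t by near: t; exact: nbhs_pinfty_ge.
  by rewrite (inv mus)// subrK.
split => //.
- move=> nu pnu inu; apply: measure_eq_lip => // f lf.
  have H := cv nu f pnu lf.
  have C : mean (Pm t nu) f @[t --> +oo] --> mean nu f.
    apply/cvgrPdist_lt => e e0; near=> t.
    have t0 : 0 <= t by near: t; exact: nbhs_pinfty_ge.
    by rewrite inv// subrr normr0.
  exact: (cvg_unique _ C H).
- move=> mu pmu f bf.
  (* [portmanteau] requires probability measures at every index, so negative times are replaced by
     0. *)
  have H : mean (Pm (Num.max 0 t) mu) f @[t --> +oo] --> mean mus f.
    apply: (portmanteau (m := fun t => Pm (Num.max 0 t) mu)) => //.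
      move=> g lg; apply: cvg_trans (cv mu g pmu lg); apply: near_eq_cvg.
      near=> t; have t0 : 0 <= t by near: t; exact: nbhs_pinfty_ge.
      by rewrite max_r.
    by move=> t; apply: (Pm_prob MF) => //; rewrite le_max lexx.
  rewrite (integE _ (bc_bb bf)); apply/fine_cvgP; split.
    by near=> t; rewrite integE//; exact: bc_bb.
  apply: cvg_trans H; apply: near_eq_cvg.
  near=> t; have t0 : 0 <= t by near: t; exact: nbhs_pinfty_ge.
  by rewrite max_r.
Unshelve. all: by end_near. Qed.

End existence.
End stability.

Theorem theorem3p16 (R : realType) (X : pmetricType R) :
  @polish R X ->
  forall (Pm : R -> fmeasure X R -> fmeasure X R) (Pf : R -> (X -> R) -> (X -> R)),
  markov_feller Pm Pf ->
  (asymptotically_stable Pm <->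
     ((forall z : X, eventually_continuous_at Pf z) /\
      exists z : X, lower_bound_cond Pm z)) /\
  ((forall z : X, eventually_continuous_at Pf z) /\ (exists z : X, lower_bound_cond Pm z)
   <->
   exists z : X, eventually_continuous_at Pf z /\ lower_bound_cond Pm z).
Proof.
move=> PX Pm Pf MF.
have stable z : eventually_continuous_at Pf z -> lower_bound_cond Pm z ->
  asymptotically_stable Pm by exact: stable_of_lower_bound.
split; split.
- exact: stable_implies.
- by move=> [ec [z lb]]; exact: stable (ec z) lb.
- by move=> [ec [z lb]]; exists z.
(* Eventual continuity spreads from one point to all points by passing through stability. *)
- by move=> [z [ec lb]]; apply: (stable_implies MF PX); exact: stable ec lb.
Qed.
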